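(* Consider the stochastic program $\min_{x\in X}\mathbb{E}[f(x,\tilde\xi)]$ and the sequential sampling procedure with Latin hypercube sampling ($s=\mathcal{L}$) and assessment procedure $a\in\{S,A\}$ (SRP, A2RP), as defined in the context. Suppose: (A$_{\text{SP}}$) (i) $f(\cdot,\tilde\xi)$ is continuous on $X$ with probability one; (ii) there is a positive real number $C$ with $\sup_{x\in X,\xi\in\Xi}|f(x,\xi)|\le C$; (iii) $X\neq\emptyset$ and $X$ is compact; (iv) the components of $\tilde\xi$ are independent, with (analytically or numerically) invertible cumulative distribution functions. (A1) The sequence of candidate solutions $\{x_k\}$ has at least one limit point in $X^*$, with probability one. Let $f(x,\tilde\xi)=\mathbb{E}[f(x,\tilde\xi)]+\sum_{j=1}^{d_\xi}f_j(x,\tilde\xi_j)+f_{resid}(x,\tilde\xi)$ be the partial ANOVA decomposition of $f(x,\cdot)$, where $f_j(x,\xi_j)=\mathbb{E}[f(x,\tilde\xi)\mid\tilde\xi_j=\xi_j]-\mathbb{E}[f(x,\tilde\xi)]$. Let $m,M$ be two finite constants such that at least one of $m>0$ or $M>0$ holds and $$-m\ \le\ \inf_{x\in X,\,\xi\in\Xi}f_{resid}(x,\xi)\ \le\ \sup_{x\in X,\,\xi\in\Xi}f_{resid}(x,\xi)\ \le\ M.$$ Suppose that for all $x\in X$ the univariate functions $f_j(x,\cdot)$, $j=1,\dots,d_\xi$, are continuous or the set of points at which they are discontinuous has Lebesgue measure zero. Let $\varepsilon>\varepsilon'>0$, $h'>0$, $p>0$ and $0<\alpha<1$ be fixed, and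 suppose $\varepsilon-\varepsilon'>m+M$. For each $h>h'$, let the sample sizes $n_k$, $k\ge1$, satisfy $$n_k\ \ge\ \Big(\frac{1}{h-h'}\Big)^2\big(c_p+2p\ln^2 k\big),\qquad c_p=\max\Big\{2\ln\Big(\sum_{j=1}^{\infty}j^{-p\ln j}\big/(\sqrt{2\pi}\,\alpha)\Big),\,1\Big\},$$ with $n_k$ even if $a=A$. Let $$T=\inf_{k\ge1}\Big\{k:\ \texttt{GAP}^a_{\mathcal{L},n_k}(x_k)\le h'\sqrt{\texttt{SV}^a_{\mathcal{L},n_k}(x_k)}+\varepsilon'\Big\}.$$ Then for both $(s,a)=(\mathcal{L},S)$ and $(s,a)=(\mathcal{L},A)$: (i) $\mathbb{P}(T<\infty)=1$; (ii) $\displaystyle\liminf_{h\downarrow h'}\ \mathbb{P}\Big\{\mathcal{G}_{x_T}\le h\sqrt{\texttt{SV}^a_{\mathcal{L},n_T}(x_T)}+\varepsilon\Big\}\ \ge\ 1-\alpha.$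
   Context: **Problem.** $X\subseteq\mathbb{R}^{d_x}$; $\tilde\xi=(\tilde\xi_1,\dots,\tilde\xi_{d_\xi})$ is a random vector with distribution $P$ (not depending on $x$) and support $\Xi\subseteq\mathbb{R}^{d_\xi}$; $f:X\times\Xi\to\mathbb{R}$ is Borel measurable. $z^*=\min_{x\in X}\mathbb{E}[f(x,\tilde\xi)]$ is the optimal value and $X^*=\operatorname{argmin}_{x\in X}\mathbb{E}[f(x,\tilde\xi)]$ the set of optimal solutions. For $x\in X$ the optimality gap is $\mathcal{G}_x=\mathbb{E}[f(x,\tilde\xi)]-z^*\ge 0$. $F_j^{-1}$ denotes the inverse of the cumulative distribution function of $\tilde\xi_j$. **ANOVA terms.** The components of $\tilde\xi$ being independent, $\mathbb{E}[f(x,\tilde\xi)\mid\tilde\xi_j=\xi_j]$ is the integral of $f(x,\cdot)$ over the remaining components with the $j$-th component fixed at $\xi_j$. The residual $f_{resid}(x,\xi)=f(x,\xi)-\mathbb{E}[f(x,\tilde\xi)]-\sum_{j}f_j(x,\xi_j)$ collects all higher-order terms. **Latin hypercube sampling (LHS, $s=\mathcal{L}$).** An LHS sample $\{\tilde\xi^1_{\mathcal{L}},\dots,\tilde\xi^n_{\mathcal{L}}\}$ of size $n$ is formed as follows, independently for each dimension $j=1,\dots,d_\xi$: draw independent $\tilde u^i_j\sim U(\frac{i-1}{n},\frac in)$, $i=1,\dots,n$; draw an independent uniformly random permutation $(\pi^1_j,\dots,\pi^n_j)$ of $\{1,\dots,n\}$; set $\tilde\xi^i_{\mathcal{L},j}=F_j^{-1}\big(\tilde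 u_j^{\pi^i_j}\big)$. **Single Replication Procedure (SRP, $a=S$).** For $x\in X$ and an LHS sample of size $n$, let $x^*_{\mathcal{L},n}$ be an optimal solution of $\min_{y\in X}\frac1n\sum_{i=1}^n f(y,\tilde\xi^i_{\mathcal{L}})$ and $$\texttt{GAP}^S_{\mathcal{L},n}(x)=\frac1n\sum_{i=1}^n\big(f(x,\tilde\xi^i_{\mathcal{L}})-f(x^*_{\mathcal{L},n},\tilde\xi^i_{\mathcal{L}})\big),$$ $$\texttt{SV}^S_{\mathcal{L},n}(x)=\frac1{n-1}\sum_{i=1}^n\Big[\big(f(x,\tilde\xi^i_{\mathcal{L}})-f(x^*_{\mathcal{L},n},\tilde\xi^i_{\mathcal{L}})\big)-\texttt{GAP}^S_{\mathcal{L},n}(x)\Big]^2.$$ **Averaged Two-Replication Procedure (A2RP, $a=A$).** With two independent LHS samples of size $n/2$ each, giving SRP estimators indexed $1$ and $2$, $$\texttt{GAP}^A_{\mathcal{L},n}(x)=\tfrac12\big(\texttt{GAP}^{S,1}_{\mathcal{L},n/2}(x)+\texttt{GAP}^{S,2}_{\mathcal{L},n/2}(x)\big),\qquad \texttt{SV}^A_{\mathcal{L},n}(x)=\tfrac12\big(\texttt{SV}^{S,1}_{\mathcal{L},n/2}(x)+\texttt{SV}^{S,2}_{\mathcal{L},n/2}(x)\big).$$ **Sequential sampling procedure.** A sequence of (random) candidate solutions $x_1,x_2,\ldots\in X$ is given, generated by any method. The assessment procedure $a$ is fixed. Parameters satisfy $h>h'>0$, $\varepsilon>\varepsilon'>0$,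 $\alpha\in(0,1)$. At iteration $k=1,2,\dots$, a completely new, independent LHS sample (or, for A2RP, pair of samples) of total size $n_k$ ($n_k\ge n_{k-1}$, $n_0=2$) is generated and $\texttt{GAP}^a_{\mathcal{L},n_k}(x_k)$, $\texttt{SV}^a_{\mathcal{L},n_k}(x_k)$ are computed from it. The samples used to assess solution quality are independent of those used to generate the candidate solutions. The procedure stops at the iteration $T$ in the claim and outputs $x_T$. Sample sizes are always large enough for the estimators to be defined. The sample sizes $n_k$, and hence $T$, depend on $h$; in (ii), $h'$ is fixed and $h$ decreases to $h'$. *)

(* Defs.v *)
From HB Require Import structures.
From mathcomp Require Import all_boot all_order all_algebra perm.
From mathcomp Require Import all_classical all_reals all_analysis measurable_realfun.

Set Implicit Arguments.
Unset Strict Implicit.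
Unset Printing Implicit Defensive.

Import Order.TTheory GRing.Theory Num.Theory.
Import numFieldNormedType.Exports.

Local Open Scope classical_set_scope.
Local Open Scope ring_scope.

(* R^n with its Borel sigma-algebra; the library equips 'rV[R]_n with a
   topology but with no measurable structure. *)
Notation borel_rV R n := (g_sigma_algebraType (@open 'rV[R]_n)).

Section random_vector.
Variables (R : realType) (d : nat).

Definition coord_rV (j : 'I_d) (xi : borel_rV R d) : R := (xi : 'rV[R]_d) 0 j.

Lemma measurable_coord_rV (j : 'I_d) : measurable_fun setT (coord_rV j).
Proof.
apply: (measurability _ (RGenOInfty.measurableE R)) => _ [_ [a ->] <-].
apply: sub_sigma_algebra; rewrite setTI.
have /continuousP := @coord_continuous R 1 d 0 j.
by apply; exact: interval_open.
Qed.

HB.instance Definition _ (j : 'I_d) :=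
  isMeasurableFun.Build _ _ (borel_rV R d) R (coord_rV j)
    (measurable_coord_rV j).

Variable P : probability (borel_rV R d) R.

Definition law_support : set 'rV[R]_d :=
  [set xi | forall U, open U -> U xi -> (0 < P U)%E].

(* The support of the law of xi_j, when the components are independent. *)
Definition marginal_support (j : 'I_d) : set R :=
  [set xi 0 j | xi in law_support].

(* Invertibility of the distribution function is understood on ]0, 1[: every
   level p in ]0, 1[ is attained, at the single point Finv p.  The values of
   Finv outside ]0, 1[ are irrelevant. *)
Definition inverse_cdf (j : 'I_d) (Finv : R -> R) : Prop :=
  forall p t, 0 < p < 1 ->
    cdf (coord_rV j : {RV P >-> R}) t = p%:E <-> t = Finv p.

End random_vector.

(* Mutual independence of a family of sigma-algebras. *)
Definition mutually_independent d (Omega : measurableType d) (R : realType)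
    (Pr : probability Omega R) (I : eqType) (E : I -> set_system Omega) : Prop :=
  forall (s : seq I) (A : I -> set Omega), uniq s ->
    (forall i, i \in s -> E i (A i)) ->
    Pr (\bigcap_(i in [set` s]) A i) = (\prod_(i <- s) Pr (A i))%E.

Section stochastic_program.
Variables (R : realType) (dx d : nat).
Variables (X : set 'rV[R]_dx) (P : probability (borel_rV R d) R).
Variable f : 'rV[R]_dx -> 'rV[R]_d -> R.

(* f is a total function, but only its values on X x law_support P are
   meaningful; hence expectations are integrals over the support, which has
   probability 1. *)
Definition Ef (x : 'rV[R]_dx) : R := \int[P]_(xi in law_support P) f x xi.

Definition zstar : R := inf [set Ef x | x in X].

Definition Xstar : set 'rV[R]_dx :=
  [set x | X x /\ forall y, X y -> Ef x <= Ef y].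

Definition optimality_gap (x : 'rV[R]_dx) : R := Ef x - zstar.

Definition set_coord (xi : 'rV[R]_d) (j : 'I_d) (t : R) : 'rV[R]_d :=
  \row_l (if l == j then t else xi 0 l).

(* Under independence of the components, E[f(x, xi) | xi_j = t] is obtained by
   freezing the j-th component at t and integrating over the other ones; the
   integrand below does not depend on the j-th component of xi. *)
Definition condE (j : 'I_d) (x : 'rV[R]_dx) (t : R) : R :=
  \int[P]_(xi in law_support P) f x (set_coord xi j t).

Definition anova_main (j : 'I_d) (x : 'rV[R]_dx) (t : R) : R :=
  condE j x t - Ef x.

Definition anova_resid (x : 'rV[R]_dx) (xi : 'rV[R]_d) : R :=
  f x xi - Ef x - \sum_(j < d) anova_main j x (xi 0 j).

End stochastic_program.

(* Points of D at which g, seen as a function on the subspace D, is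
   discontinuous. *)
Definition discontinuities (R : realType) (D : set R) (g : R -> R) : set R :=
  [set t | D t /\ ~ (g @ within D (nbhs t) --> g t)].

Section latin_hypercube.
Variable R : realType.

Lemma stratum_lt n (i : 'I_n) : i%:R / n%:R < i.+1%:R / n%:R :> R.
Proof.
by rewrite ltr_pM2r ?ltr_nat// invr_gt0 ltr0n (leq_ltn_trans _ (ltn_ord i)).
Qed.

(* Stratum indices start at 0: the i-th of the n strata is ]i/n, (i+1)/n[.
   Draws lie in their open stratum surely, so that Finv is only evaluated
   inside ]0, 1[ and sample points lie in the support. *)
Definition stratified_draw d (Omega : measurableType d)
    (Pr : probability Omega R) n (i : 'I_n) (u : {RV Pr >-> R}) : Prop :=
  (forall w, i%:R / n%:R < u w < i.+1%:R / n%:R) /\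
  forall A, measurable A ->
    distribution Pr u A = uniform_prob (stratum_lt i) A.

Definition uniform_permutation d (Omega : measurableType d)
    (Pr : probability Omega R) n (sigma : Omega -> 'S_n) : Prop :=
  forall s : 'S_n, measurable (sigma @^-1` [set s]) /\
    Pr (sigma @^-1` [set s]) = (n`!%:R^-1)%:E.

Definition lhs_sample d n (Finv : 'I_d -> R -> R) (u : 'I_d -> 'I_n -> R)
    (sigma : 'I_d -> 'S_n) (i : 'I_n) : 'rV[R]_d :=
  \row_j Finv j (u j (sigma j i)).

(* Sources of randomness of a run using q replications per iteration and m k
   points per replication at iteration k: None is the whole sequence of
   candidates, the other indices are the single uniform draws and the single
   permutations. *)
Definition source (m : nat -> nat) (q d : nat) : eqType :=
  option ({k : nat & ('I_q * 'I_d * 'I_(m k))%type} + nat * 'I_q * 'I_d)%type.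

Definition source_sigma dO (Omega : measurableType dO)
    (Pr : probability Omega R) (dx d q : nat) (m : nat -> nat)
    (x_ : nat -> {RV Pr >-> borel_rV R dx})
    (u : forall k, 'I_q -> 'I_d -> 'I_(m k) -> {RV Pr >-> R})
    (sigma : forall k, 'I_q -> 'I_d -> Omega -> 'S_(m k))
    (c : source m q d) : set_system Omega :=
  match c with
  | None =>
      <<s \bigcup_k preimage_set_system setT (x_ k) measurable >>
  | Some (inl (existT k (r, j, i))) =>
      preimage_set_system setT (u k r j i) measurable
  | Some (inr (k, r, j)) =>
      preimage_set_system setT (sigma k r j) setT
  end.

End latin_hypercube.

Inductive assessment := SRP | A2RP.

Definition nrep (a : assessment) : nat :=
  match a with SRP => 1 | A2RP => 2 end.

Section estimators.
Variables (R : realType) (dx d : nat).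
Variable f : 'rV[R]_dx -> 'rV[R]_d -> R.

Definition saa_optimal (X : set 'rV[R]_dx) n (s : 'I_n -> 'rV[R]_d)
    (x : 'rV[R]_dx) : Prop :=
  X x /\ forall y, X y ->
    n%:R^-1 * \sum_(i < n) f x (s i) <= n%:R^-1 * \sum_(i < n) f y (s i).

(* y stands for the solution of the sample average problem. *)
Definition gapS n (x y : 'rV[R]_dx) (s : 'I_n -> 'rV[R]_d) : R :=
  n%:R^-1 * \sum_(i < n) (f x (s i) - f y (s i)).

Definition svS n (x y : 'rV[R]_dx) (s : 'I_n -> 'rV[R]_d) : R :=
  (n.-1%:R)^-1 *
    \sum_(i < n) ((f x (s i) - f y (s i)) - gapS x y s) ^+ 2.

Definition gap a n (x : 'rV[R]_dx) (y : 'I_(nrep a) -> 'rV[R]_dx)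
    (s : 'I_(nrep a) -> 'I_n -> 'rV[R]_d) : R :=
  (nrep a)%:R^-1 * \sum_(r < nrep a) gapS x (y r) (s r).

Definition sv a n (x : 'rV[R]_dx) (y : 'I_(nrep a) -> 'rV[R]_dx)
    (s : 'I_(nrep a) -> 'I_n -> 'rV[R]_d) : R :=
  (nrep a)%:R^-1 * \sum_(r < nrep a) svS x (y r) (s r).

End estimators.

Definition c_p (R : realType) (p alpha : R) : R :=
  Num.max
    (2 * ln (limn (series (fun j : nat =>
               j.+1%:R `^ (- p * ln j.+1%:R))) /
             (Num.sqrt (2 * pi) * alpha)))
    1.

(* Iterations are stored from index 0: index k is iteration k.+1. *)
Definition stopping_time (R : realType) (Omega : Type)
    (h' eps' : R) (GAP SV : nat -> Omega -> R) (w : Omega) : \bar R :=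
  ereal_inf [set k.+1%:R%:E |
    k in [set k | GAP k w <= h' * Num.sqrt (SV k w) + eps']].

(* Main.v *)
From HB Require Import structures.
Require Import Defs.
From mathcomp Require Import all_boot all_order all_algebra perm.
From mathcomp Require Import all_classical all_reals all_analysis measurable_realfun.
From mathcomp Require Import ring lra.

Set Implicit Arguments.
Unset Strict Implicit.
Unset Printing Implicit Defensive.

Import Order.TTheory GRing.Theory Num.Theory.
Import numFieldNormedType.Exports.

Local Open Scope classical_set_scope.
Local Open Scope ring_scope.

(** The statement follows from a uniform law of large numbers for Latin
    hypercube samples whose failure probability is geometric in the sample size.
    Call a sample accurate when its averages of [f x] are within [eta] of
    [Ef P f x] for every [x] in [X] at once.  On an accurate sample the gap
    estimator is within [2 * eta] of the true optimality gap of the candidate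
    ([gap_le], [gap_ge]), whatever the candidate and whichever solution of the
    sample problem is used.  Hence an iteration can only mislead the procedure
    when its own sample is not accurate.

    Concentration ([hits_tail]).  Let [S] be the number of points of a sample of
    size [n] that fall in a Borel set [A].  Its falling factorial of order [k]
    counts the ordered [k]-tuples of distinct sample points in [A].  Given the
    permutations, the points are independent ([sample_given_permutations]), and
    counting the permutations that extend a given injection shows that [k] points
    have a joint law of density at most (n ^ k / n ^_ k) ^ d with respect to
    independent points of law [P] ([lhs_all_in_le]).  When [k] is a small fixed
    fraction of [n] this factor is at most (1 + c) ^ k for a small [c], so
    Markov's inequality for the falling factorial bounds the probability that [S]
    reaches n * (P(A) + t) by the [k]-th power of a constant below 1.

    From sets to decisions ([uniform_lln_test_sets]).  For almost every [xi] the
    function f(., xi) is uniformly continuous on the compact set [X], so outside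
    a set of small probability it has a common modulus of continuity
    ([exists_equicontinuous_set]).  A finite net of [X] then reduces accuracy to
    finitely many functions, and slicing these bounded functions into superlevel
    sets ([mean_le_test_sets]) reduces it to the frequencies of finitely many
    Borel sets.

    Sequential procedure.  With sample sizes of order D * ln(k)^2, where [D] is
    (h - h')^-2, the probabilities that the sample of iteration [k] is not
    accurate have a finite sum, which tends to 0 as [D] grows
    ([sum_error_probabilities]).  By Borel-Cantelli almost surely all but finitely
    many samples are accurate; since a limit point of the candidates is optimal,
    some candidate with a tiny gap is assessed by an accurate sample, and the
    procedure stops ([stops_almost_surely]).  If every sample is accurate, the
    stopping inequality bounds the true gap by h' * sqrt(SV) + eps' + 2 * eta;
    hence the probability of a wrong output is at most the sum of the error
    probabilities ([stopped_gap_probability]), which is at most [alpha] for [h]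
    close to [h']. *)

(** * Borel sets of row vectors *)

Section borel_row_vectors.
Variables (R : realType) (d : nat).

Definition rational_box (q : {ffun 'I_d -> rat} * nat) : set 'rV[R]_d :=
  [set x | forall j, `|ratr (q.1 j) - x 0 j| < q.2.+1%:R^-1].

(** Rational boxes form a countable base, so that statements on open sets become
    statements on countable unions of boxes. *)
Lemma open_rational_boxes (U : set 'rV[R]_d) : open U ->
  U = \bigcup_(q in [set q | rational_box q `<=` U]) rational_box q.
Proof.
move=> oU; apply/seteqP; split=> [x Ux|x [q]]; last exact.
have /nbhs_ballP[e e0 xeU] : nbhs x U by exact: open_nbhs_nbhs.
have [m] : exists m : nat, 0 + m.+1%:R^-1 < e / 2.
  by apply: ltr_add_invr; rewrite divr_gt0.
rewrite add0r => me.
have m0 : 0 < m.+1%:R^-1 :> R by rewrite invr_gt0.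
have near_x (j : 'I_d) : exists q : rat, `|ratr q - x 0 j| < m.+1%:R^-1.
  have : x 0 j < x 0 j + m.+1%:R^-1 by rewrite ltrDl.
  move=> /rat_in_itvoo[q]; rewrite in_itv/= => /andP[xq qx].
  by exists q; rewrite gtr0_norm ?subr_gt0// ltrBlDl.
pose q := [ffun j => projT1 (cid (near_x j))].
have qx j : `|ratr (q j) - x 0 j| < m.+1%:R^-1.
  by rewrite ffunE; exact: (projT2 (cid (near_x j))).
exists (q, m) => // y qy; apply: xeU; split=> // i j; rewrite [i]ord1 /ball/=.
have {}qy : `|ratr (q j) - y 0 j| < m.+1%:R^-1 := qy j.
rewrite -(subrK (ratr (q j)) (x 0 j)) -addrA (le_lt_trans (ler_normD _ _))//.
by rewrite distrC (splitr e) ltrD// (lt_trans _ me).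
Qed.

Definition box (B : 'I_d -> set R) : set 'rV[R]_d :=
  [set x | forall j, B j (x 0 j)].

Definition measurable_boxes : set_system 'rV[R]_d :=
  [set box B | B in [set B | forall j, measurable (B j)]].

Lemma box_bigcap (B : 'I_d -> set R) :
  box B = \bigcap_(j in [set: 'I_d]) ((fun x : 'rV[R]_d => x 0 j) @^-1` B j).
Proof. by apply/seteqP; split=> [x Bx j _|x Bx j]; apply: Bx. Qed.

(** Boxes are a generating pi-system adapted to independent coordinates. *)
Lemma borel_rVE :
  @measurable _ (borel_rV R d) = <<s measurable_boxes >>.
Proof.
apply/seteqP; split.
  apply: smallest_sub; first exact: smallest_sigma_algebra.
  move=> U /open_rational_boxes ->.
  rewrite bigcup_mkcond.
  apply: (@countable_bigcupT_measurable _ (g_sigma_algebraType measurable_boxes)).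
    exact: countableP.
  move=> q; case: ifPn => _; last first.
    exact: (@measurable0 _ (g_sigma_algebraType measurable_boxes)).
  apply: sub_sigma_algebra.
  exists (fun j => ball (ratr (q.1 j) : R) q.2.+1%:R^-1) => // j.
  exact: measurable_ball.
apply: smallest_sub.
  exact: (@sigma_algebra_measurable _ (borel_rV R d)).
move=> _ [B mB <-]; rewrite box_bigcap.
apply: (@fin_bigcap_measurable _ (borel_rV R d)) => // j _.
rewrite -[X in measurable X]setTI.
exact: (@measurable_coord_rV R d j) _ _ (mB j).
Qed.

Lemma measurable_boxesI : setI_closed measurable_boxes.
Proof.
move=> _ _ [A mA <-] [B mB <-].
exists (fun j => A j `&` B j); first by move=> j; exact: measurableI.
apply/seteqP; split=> [x ABx|x [Ax Bx] j]; last by split; [exact: Ax|exact: Bx].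
by split=> j; case: (ABx j).
Qed.

Lemma measurable_boxesT : measurable_boxes setT.
Proof.
by exists (fun=> setT) => //; apply/seteqP; split.
Qed.

Lemma measurable_box (B : 'I_d -> set R) : (forall j, measurable (B j)) ->
  measurable (box B : set (borel_rV R d)).
Proof. by move=> mB; rewrite borel_rVE; apply: sub_sigma_algebra; exists B. Qed.

Lemma measurable_fun_rV d' (T : measurableType d') (f : T -> borel_rV R d) :
  (forall j, measurable_fun setT (fun w => (f w : 'rV[R]_d) 0 j)) ->
  measurable_fun setT f.
Proof.
move=> mf; apply: (measurability _ borel_rVE) => _ [_ [B mB <-] <-].
rewrite box_bigcap preimage_bigcap setTI.
apply: fin_bigcap_measurable => // j _.
by rewrite -[X in measurable X]setTI; exact: mf.
Qed.

Lemma closed_law_support (P : probability (borel_rV R d) R) :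
  closed (law_support P).
Proof.
rewrite -[law_support P]setCK; apply: open_closedC.
rewrite openE => x /=.
move=> /existsNP[U /not_implyP[oU /not_implyP[Ux PU]]].
apply: (filterS _ (open_nbhs_nbhs (conj oU Ux))) => y Uy.
by move=> /(_ U oU Uy); exact: PU.
Qed.

Lemma measurable_closed_rV (A : set 'rV[R]_d) : closed A ->
  measurable (A : set (borel_rV R d)).
Proof.
move=> cA; rewrite -[A]setCK; apply: (@measurableC _ (borel_rV R d)).
by apply: sub_sigma_algebra; exact: closed_openC.
Qed.

Lemma measurable_law_support (P : probability (borel_rV R d) R) :
  measurable (law_support P : set (borel_rV R d)).
Proof. by apply: measurable_closed_rV; exact: closed_law_support. Qed.

Lemma open_rational_box q : open (rational_box q).
Proof.
rewrite openE => x qx.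
exists (fun _ j => ball (ratr (q.1 j) : R) q.2.+1%:R^-1) => [i j|y qy j].
  rewrite [i]ord1; apply: open_nbhs_nbhs; split; last exact: qx.
  by apply: ball_open; rewrite invr_gt0.
exact: qy.
Qed.

(** The complement of the support is the union of the null rational boxes, a
    countable union. *)
Lemma probability_law_support (P : probability (borel_rV R d) R) :
  P (law_support P) = 1%E.
Proof.
have mS := measurable_law_support P.
suff : P (~` law_support P) = 0%E.
  by rewrite probability_setC// => /eqP; rewrite sube_eq// add0e => /eqP.
have -> : ~` law_support P =
    \bigcup_(q in [set q | P (rational_box q) = 0%E]) rational_box q.
  apply/seteqP; split=> [x /existsNP[U /not_implyP[oU /not_implyP[Ux PU]]]|].
    have := Ux; rewrite {1}(open_rational_boxes oU) => -[q /= qU qx].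
    exists q => //=; apply/eqP; rewrite eq_le measure_ge0 andbT.
    have /negP := PU; rewrite -leNgt; apply: le_trans.
    apply: le_measure => //; rewrite inE; last exact: sub_sigma_algebra.
    by apply: sub_sigma_algebra; exact: open_rational_box.
  move=> x [q /= Pq qx] /(_ _ (@open_rational_box q) qx).
  by rewrite Pq ltxx.
rewrite bigcup_mkcond.
set F := (F in \bigcup_i F i).
have [f /= fK] : exists f : nat -> {ffun 'I_d -> rat} * nat,
    forall q, exists k, f k = q.
  exists (fun k => odflt ([ffun=> 0], 0%N) (choice.unpickle k)) => q.
  by exists (choice.pickle q); rewrite choice.pickleK.
have -> : \bigcup_i F i = \bigcup_k F (f k).
  apply/seteqP; split=> [x [q _ Fx]|x [k _ Fx]]; last by exists (f k).
  by have [k fkq] := fK q; exists k => //; rewrite fkq.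
have mF k : measurable (F (f k) : set (borel_rV R d)).
  rewrite /F; case: ifPn => // _.
  by apply: sub_sigma_algebra; exact: open_rational_box.
apply: measure_negligible; first exact: bigcupT_measurable.
apply: negligible_bigcup => k; apply/negligibleP => //.
by rewrite /F; case: ifPn => [|_]; [rewrite inE|exact: measure0].
Qed.

End borel_row_vectors.
(** * Independent random vectors: from boxes to Borel sets *)

Section product_extension.
Context (R : realType) (d : nat).

Lemma rV_measure_unique (m1 m2 : {measure set (borel_rV R d) -> \bar R}) :
  (m1 setT < +oo)%E ->
  (forall B : 'I_d -> set R, (forall j, measurable (B j)) ->
    m1 (box B) = m2 (box B)) ->
  forall A, measurable A -> m1 A = m2 A.
Proof.
move=> m1oo m12 A mA.
apply: (@measure_unique _ R (borel_rV R d) (@measurable_boxes R d) (fun=> setT)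
  (@borel_rVE R d) (@measurable_boxesI R d)) => //.
- by move=> _; exact: measurable_boxesT.
- by rewrite bigcup_const//; exists 0%N.
- by move=> _ [B mB <-]; exact: m12.
Qed.

Context d' (T : measurableType d') (Pr : probability T R).

Lemma rV_independent_event (y : {mfun T >-> borel_rV R d}) (D : set T) (c : R) :
  measurable D -> 0 <= c ->
  (forall B : 'I_d -> set R, (forall j, measurable (B j)) ->
    fine (Pr (D `&` y @^-1` box B)) = c * fine (Pr (y @^-1` box B))) ->
  forall A, measurable A ->
    fine (Pr (D `&` y @^-1` A)) = c * fine (Pr (y @^-1` A)).
Proof.
move=> mD c0 DB A mA.
have my C : measurable C -> measurable (y @^-1` C).
  by move=> mC; rewrite -[X in measurable X]setTI; exact: measurable_funPT.
pose m1 : {measure set _ -> \bar R} := pushforward (mrestr Pr mD) y.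
pose m2 : {measure set _ -> \bar R} := mscale (NngNum c0) (pushforward Pr y).
have mfy : measurable_fun setT y by exact: measurable_funPT.
suff : m1 mfy A = m2 mfy A.
  rewrite /m1 /m2 /= /mscale/= /pushforward /mrestr setIC => ->.
  by rewrite fineM// fin_num_measure//; exact: my.
apply: rV_measure_unique => //.
  rewrite /m1 /= /pushforward /mrestr preimage_setT setTI.
  by rewrite (le_lt_trans (probability_le1 _ mD))// ltry.
move=> B mB; rewrite /m1 /m2 /= /mscale/= /pushforward /mrestr setIC.
have mb : measurable (y @^-1` box B) by apply: my; exact: measurable_box.
have mDb := measurableI _ _ mD mb.
by rewrite -[LHS]fineK ?fin_num_measure// DB// EFinM fineK// fin_num_measure.
Qed.

(** Both sides are finite measures in each [A i] separately, hence determined by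
    their values on boxes; the boxes are replaced by arbitrary Borel sets one index
    at a time. *)
Lemma rV_independent_family n (y : 'I_n -> {mfun T >-> borel_rV R d})
    (D : set T) (c : R) : measurable D -> 0 <= c ->
  (forall B : 'I_n -> 'I_d -> set R, (forall i j, measurable (B i j)) ->
    fine (Pr (D `&` \big[setI/setT]_(i < n) (y i @^-1` box (B i)))) =
    c * \prod_(i < n) fine (Pr (y i @^-1` box (B i)))) ->
  forall A : 'I_n -> set (borel_rV R d), (forall i, measurable (A i)) ->
    fine (Pr (D `&` \big[setI/setT]_(i < n) (y i @^-1` A i))) =
    c * \prod_(i < n) fine (Pr (y i @^-1` A i)).
Proof.
move=> mD c0 DB A mA.
have my i C : measurable C -> measurable (y i @^-1` C).
  by move=> mC; rewrite -[X in measurable X]setTI; exact: measurable_funPT.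
suff H m (C : 'I_n -> set (borel_rV R d)) : (forall i, measurable (C i)) ->
    (forall i : 'I_n, (m <= i)%N -> @measurable_boxes R d (C i)) ->
    fine (Pr (D `&` \big[setI/setT]_(i < n) (y i @^-1` C i))) =
    c * \prod_(i < n) fine (Pr (y i @^-1` C i)).
  by apply: (H n) => // i; rewrite leqNgt ltn_ord.
(* Induction on the number [m] of indices whose set may be arbitrary. *)
elim: m C => [|m IH] C mC Cbox.
  have /choice[B CB] i : exists B : 'I_d -> set R,
      (forall j, measurable (B j)) /\ C i = box B.
    by have [B mB <-] := Cbox i isT; exists B.
  under eq_bigr do rewrite (CB _).2.
  under [in RHS]eq_bigr do rewrite (CB _).2.
  by apply: DB => i j; exact: (CB i).1.
have [nm|mn] := leqP n m.
  apply: IH => // i mi; have := leq_trans nm mi.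
  by rewrite leqNgt ltn_ord.
pose i0 := Ordinal mn.
rewrite (bigD1 i0)//= [in RHS](bigD1 i0)//= setIA (setIAC D) mulrA (mulrAC c).
apply: rV_independent_event => //.
- apply: measurableI => //; apply: bigsetI_measurable => i _; exact: my.
- rewrite mulr_ge0// prodr_ge0// => i _; exact: fine_ge0.
- move=> B mB.
  pose C' i := if i == i0 then box B : set (borel_rV R d) else C i.
  have := IH C'; rewrite (bigD1 i0)//= [in RHS](bigD1 i0)//=.
  rewrite setIA (setIAC D) mulrA (mulrAC c).
  have -> : C' i0 = box B by rewrite /C' eqxx.
  have E1 : \big[setI/setT]_(i < n | i != i0) (y i @^-1` C' i) =
      \big[setI/setT]_(i < n | i != i0) (y i @^-1` C i).
    by apply: eq_bigr => i /negbTE ii0; rewrite /C' ii0.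
  have E2 : \prod_(i < n | i != i0) fine (Pr (y i @^-1` C' i)) =
      \prod_(i < n | i != i0) fine (Pr (y i @^-1` C i)).
    by apply: eq_bigr => i /negbTE ii0; rewrite /C' ii0.
  rewrite E1 E2; apply.
  + by move=> i; rewrite /C'; case: ifP => // _; exact: measurable_box.
  + move=> i mi; rewrite /C'; case: eqP => [_|/eqP ii0]; first by exists B.
    by apply: Cbox; rewrite ltn_neqAle mi andbT; apply: contraNneq ii0 => mi'; apply/eqP/val_inj.
Qed.

End product_extension.
(** * Counting permutations that extend an injection *)

Section extending_permutations.

(** Two such permutations differ by one that fixes the [k] values of [iota]. *)
Lemma card_perm_extending n k (iota tau : 'I_k -> 'I_n) : injective iota ->
  (#|[set s : 'S_n | [forall i, s (iota i) == tau i]]%SET| <= (n - k)`!)%N.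
Proof.
move=> iota_inj; set F := finset.finset _.
have [->|[s0 s0F]] := set_0Vmem F; first by rewrite cards0.
pose A := (~: [set iota i | i : 'I_k])%SET.
have cA : #|A| = (n - k)%N.
  by rewrite cardsCs finset.setCK card_imset// !card_ord.
rewrite -cA -card_perm -(card_imset _ (@mulIg _ s0^-1%g)).
apply: subset_leq_card; apply/fintype.subsetP => _ /imsetP[s sF ->].
rewrite unfold_in; apply/fintype.subsetP => x; rewrite inE; apply: contraR.
rewrite finset.in_setC negbK => /imsetP[i _ ->].
move: s0F sF; rewrite !inE => /forallP/(_ i)/eqP s0i /forallP/(_ i)/eqP si.
by rewrite permM si -s0i permK.
Qed.

(** Grouping the [d] permutations by the cells in which they put the [k] points
    turns sampling without replacement into sampling with replacement, up to the
    number of permutations per group. *)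
Lemma sum_perm_prod_le (R : realType) n k d (iota : 'I_k -> 'I_n)
    (q : {ffun 'I_d -> 'I_n} -> R) : injective iota -> (forall c, 0 <= q c) ->
  \sum_(s : {ffun 'I_d -> 'S_n}) \prod_(i < k) q [ffun j => s j (iota i)] <=
  ((n - k)`!%:R ^+ d) * (\sum_c q c) ^+ k.
Proof.
move=> iota_inj q0.
pose cell (s : {ffun 'I_d -> 'S_n}) := [ffun i : 'I_k => [ffun j => s j (iota i)]].
rewrite (partition_big cell xpredT)//=.
have -> : (\sum_c q c) ^+ k = \prod_(i < k) \sum_c q c.
  by rewrite prodr_const card_ord.
rewrite bigA_distr_bigA/= mulr_sumr.
apply: ler_sum => tau _.
rewrite (eq_bigr (fun=> \prod_(i < k) q (tau i))); last first.
  by move=> s /eqP <-; apply: eq_bigr => i _; rewrite !ffunE.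
rewrite sumr_const -[leLHS]mulr_natl ler_wpM2r// ?prodr_ge0// -natrX ler_nat.
pose F j := [set s : 'S_n | [forall i, s (iota i) == tau i j]]%SET.
apply: (@leq_trans (\prod_(j < d) #|F j|)); last first.
  rewrite -[X in (_ <= _ ^ X)%N](card_ord d) -prod_nat_const.
  by apply: leq_prod => j _; exact: card_perm_extending.
have -> : (\prod_(j < d) #|F j| = #|family (fun j => mem (F j))|)%N.
  by rewrite card_family foldrE big_map big_enum.
apply: subset_leq_card; apply/fintype.subsetP => s; rewrite unfold_in => cs.
have {}cs : cell s = tau by apply/eqP.
apply/familyP => j; rewrite inE; apply/forallP => i.
by rewrite -cs !ffunE.
Qed.
End extending_permutations.
(** * Quantile transform of stratified draws *)

Section sum_of_measures.
Context d (T : measurableType d) (R : realType) (I : finType) (i0 : I).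
Variables (G : set_system T) (g : (set T)^nat).
Hypotheses (mG : measurable = <<s G >>) (setIG : setI_closed G).
Hypotheses (Gg : forall k, G (g k)) (g_cover : \bigcup_k g k = setT).
Variables (m1 : I -> {measure set T -> \bar R}) (m2 : {measure set T -> \bar R}).
Hypothesis m2oo : forall k, (m2 (g k) < +oo)%E.

Lemma sum_measure_unique : (forall A, G A -> (\sum_i m1 i A = m2 A)%E) ->
  forall A, measurable A -> (\sum_i m1 i A = m2 A)%E.
Proof.
move=> m12 A mA.
pose m : {measure set T -> \bar R} :=
  msum (fun k => m1 (nth i0 (index_enum I) k)) (size (index_enum I)).
have mE B : m B = (\sum_i m1 i B)%E.
  by rewrite /m /= /msum (big_nth i0) big_mkord.
rewrite -mE; apply: (measure_unique G g) => //.
- by move=> B GB; rewrite mE m12.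
- by move=> k; rewrite mE m12.
Qed.

End sum_of_measures.

Section quantile_transform.
Context (R : realType) (d : nat) (P : probability (borel_rV R d) R).
Variables (j : 'I_d) (Q : R -> R).
Hypothesis Qinv : inverse_cdf P j Q.
Let F : R -> \bar R := cdf (coord_rV j : {RV P >-> R}).

(** Galois connection between the quantile and the distribution function. *)
Lemma quantile_le p t : 0 < p < 1 -> (Q p <= t) = (p%:E <= F t)%E.
Proof.
move=> p01; have FQ : F (Q p) = p%:E by apply/(Qinv _ p01).
apply/idP/idP => [Qt|pFt].
  by rewrite -FQ; apply: cdf_nondecreasing.
rewrite leNgt; apply/negP => tQ.
suff /(Qinv _ p01) tE : F t = p%:E by rewrite tE ltxx in tQ.
by apply/eqP; rewrite eq_le pFt andbT -FQ; apply: cdf_nondecreasing; exact: ltW.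
Qed.

Lemma quantile_gt p t : 0 < p < 1 -> (t < Q p) = (F t < p%:E)%E.
Proof. by move=> p01; rewrite !ltNge quantile_le. Qed.

Lemma measurable_quantile01 : measurable_fun (`]0, 1[ : set R) Q.
Proof.
apply: (measurability _ (RGenOInfty.measurableE R)) => _ [_ [t ->] <-].
have -> : `]0, 1[ `&` Q @^-1` `]t, +oo[ = `]0, 1[ `&` `](fine (F t)), +oo[%classic.
  apply/seteqP; split=> p [p01]; rewrite /= !in_itv/= !andbT => Fp; split=> //;
    by move: Fp p01; rewrite /= !in_itv/= => + p01; rewrite quantile_gt//;
      rewrite -lte_fin fineK// fin_num_measure.
exact: measurableI.
Qed.

Context d' (T : measurableType d') (Pr : probability T R).

Lemma measurable_quantile (u : T -> R) : measurable_fun setT u ->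
  (forall w, 0 < u w < 1) -> measurable_fun setT (Q \o u).
Proof.
move=> mu u01; apply: (measurable_comp _ _ measurable_quantile01) => //.
by move=> _ [w _ <-]; rewrite /= in_itv/=.
Qed.

(** The level [p] is attained only at [Q p], so the distribution function is
    strictly smaller to the left of [Q p]. *)
Lemma marginal_ball_gt0 p e : 0 < p < 1 -> 0 < e ->
  (0 < P (coord_rV j @^-1` ball (Q p) e))%E.
Proof.
move=> p01 e0; have FQ : F (Q p) = p%:E by apply/(Qinv _ p01).
have lt_p : (F (Q p - e / 2) < p%:E)%E.
  by rewrite -quantile_gt// ltrBlDr ltrDl divr_gt0.
have mpre A : measurable A -> measurable (coord_rV j @^-1` A).
  by move=> mA; rewrite -[X in measurable X]setTI; exact: measurable_coord_rV.
have := lt_p; rewrite -FQ /F /cdf /distribution/= /pushforward/=.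
have -> : coord_rV j @^-1` `]-oo, Q p] = coord_rV j @^-1` `]-oo, (Q p - e / 2)]
    `|` coord_rV j @^-1` `](Q p - e / 2), (Q p)].
  rewrite -preimage_setU; congr (_ @^-1` _); apply/seteqP; split=> x /=;
    rewrite !in_itv/=; [case: (leP x (Q p - e/2)); [by left|by right]|].
  by case=> [/le_trans|/andP[]//]; apply; rewrite gerBl divr_ge0// ltW.
rewrite measureU//=.
- rewrite lteDl ?fin_num_measure//; last exact: mpre.
  move=> /lt_le_trans; apply; apply: le_measure; rewrite ?inE; try exact: mpre.
    by apply: mpre; exact: measurable_ball.
  move=> x /=; rewrite in_itv/= /ball/= => /andP[x1 x2].
  by rewrite ger0_norm ?subr_ge0//; lra.
- exact: mpre.
- exact: mpre.
- apply/seteqP; split=> // x [] /=; rewrite !in_itv/= => x1 /andP[x2 _].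
  by move: (lt_le_trans x2 x1); rewrite ltxx.
Qed.

End quantile_transform.
Section strata.
Context (R : realType).

Lemma uniform_prob_gt (a b v : R) (ab : a < b) :
  uniform_prob ab `]v, +oo[ = ((Num.max b v - Num.max a v) / (b - a))%:E.
Proof.
rewrite /uniform_prob integral_uniform_pdf.
rewrite (eq_integral (fun=> (b - a)^-1%:E)); last first.
  by move=> x; rewrite inE/= !in_itv/= /uniform_pdf => -[_ ->].
have mI : measurable (`]v, +oo[ `&` `[a, b] : set R) by exact: measurableI.
rewrite integral_cst// [RHS]EFinM muleC; congr (_ * _)%E.
have [av|va] := ltP v a.
  have -> : `]v, +oo[ `&` `[a, b] = `[a, b]%classic.
    apply/seteqP; split=> x /=; rewrite !in_itv/= ?andbT; first by case.
    by move=> /andP[ax ->]; rewrite ax (lt_le_trans av ax).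
  rewrite /= lebesgue_measure_itv/= lte_fin ab -EFinB; congr (_ - _)%:E.
  by rewrite max_l// ltW// (lt_trans av).
have -> : `]v, +oo[ `&` `[a, b] = `]v, b]%classic.
  apply/seteqP; split=> x /=; rewrite !in_itv/= ?andbT; first by case=> -> /andP[].
  by move=> /andP[vx ->]; rewrite vx (ltW (le_lt_trans va vx)).
by rewrite /= lebesgue_measure_itv/= lte_fin; case: ltP => _; rewrite ?subrr// EFinB.
Qed.

Context d' (T : measurableType d') (Pr : probability T R).

Lemma stratified_draw01 n (i : 'I_n) (u : {RV Pr >-> R}) :
  stratified_draw i u -> forall w, 0 < u w < 1.
Proof.
move=> [+ _] w => /(_ w)/andP[iu ui].
rewrite (le_lt_trans _ iu) ?divr_ge0//= (lt_le_trans ui)//.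
by rewrite ler_pdivrMr ?ltr0n ?(leq_ltn_trans _ (ltn_ord i))// mul1r ler_nat.
Qed.

(** The contributions of the strata telescope. *)
Lemma sum_stratified_gt n (u : 'I_n -> {RV Pr >-> R}) v :
  (0 < n)%N -> (forall i, stratified_draw i (u i)) -> 0 <= v <= 1 ->
  (\sum_(i < n) Pr (u i @^-1` `]v, +oo[) = (n%:R * (1 - v))%:E)%E.
Proof.
move=> n0 uS /andP[v0 v1].
have nR0 : n%:R != 0 :> R by rewrite pnatr_eq0 -lt0n.
pose c i := n%:R * Num.max (i%:R / n%:R) v.
rewrite (eq_bigr (fun i : 'I_n => (c i.+1 - c i)%:E)); last first.
  move=> i _; have := (uS i).2 `]v, +oo[%classic; rewrite /distribution/= /pushforward.
  move=> ->//; rewrite uniform_prob_gt; congr _%:E.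
  rewrite -mulrBl -[X in _ / (X / _)]natrB// subSnn div1r invrK /c.
  by rewrite mulrC mulrBr.
rewrite sumEFin -(big_mkord xpredT (fun i => c i.+1 - c i)).
rewrite telescope_sumr// /c divff// mul0r max_l// max_r//.
by rewrite mulrBr.
Qed.

Context (d : nat) (P : probability (borel_rV R d) R) (j : 'I_d) (Q : R -> R).
Hypothesis Qinv : inverse_cdf P j Q.

(** The equally weighted mixture of the strata is uniform on ]0, 1[, and the
    quantile function maps the uniform law to the marginal law. *)
Lemma sum_stratified_quantile n (u : 'I_n -> {RV Pr >-> R}) :
  (0 < n)%N -> (forall i, stratified_draw i (u i)) ->
  forall B, measurable B ->
    (\sum_(i < n) Pr ((Q \o u i) @^-1` B) = n%:R%:E * P (coord_rV j @^-1` B))%E.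
Proof.
move=> n0 uS.
have mQ i : measurable_fun setT (Q \o u i).
  apply: (measurable_quantile Qinv) => //.
  exact: stratified_draw01 (uS i).
pose m1 i : {measure set R -> \bar R} := pushforward Pr (Q \o u i).
pose m2 : {measure set R -> \bar R} :=
  mscale (NngNum (ler0n R n)) (distribution P (coord_rV j : {RV P >-> R})).
suff : forall B, measurable B -> (\sum_i m1 mQ i B = m2 B)%E by [].
apply: (@sum_measure_unique _ _ _ _ (Ordinal n0) (@RGenOInfty.G R)
  (fun k => `](- k%:R), +oo[%classic)).
- exact: RGenOInfty.measurableE.
- move=> _ _ [a ->] [b ->]; exists (Num.max a b); apply/seteqP.
  split=> x /=; rewrite !in_itv/= !andbT gt_max; first by move=> [-> ->].
  by move=> /andP[].
- by move=> k; exists (- k%:R).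
- apply/seteqP; split=> // x _.
  exists (Num.bound `|x|) => //=; rewrite in_itv/= andbT ltrNl.
  by rewrite (le_lt_trans (ler_norm _))// normrN archi_boundP.
- move=> k; rewrite /m2 /= /mscale/= -ge0_fin_numE ?mule_ge0 ?lee_fin//.
  by rewrite fin_numM// fin_num_measure//.
- move=> _ [t ->].
  rewrite /m1 /m2 /= /mscale/= /distribution /pushforward/=.
  pose F := cdf (coord_rV j : {RV P >-> R}).
  have Ft : F t \is a fin_num by rewrite fin_num_measure.
  under eq_bigr => i _.
    have -> : (Q \o u i) @^-1` `]t, +oo[ = u i @^-1` `](fine (F t)), +oo[.
      apply/seteqP; split=> w; have u01 := stratified_draw01 (uS i) w;
        by rewrite /= !in_itv/= !andbT (quantile_gt Qinv)// -lte_fin fineK.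
    over.
  rewrite sum_stratified_gt//; last first.
    by rewrite fine_ge0//= -lee_fin fineK//; exact: cdf_le1.
  rewrite EFinM EFinB fineK//; congr (_ * _)%E.
  have -> : coord_rV j @^-1` `]t, +oo[ = ~` (@coord_rV R d j @^-1` `]-oo, t]).
    by rewrite preimage_setC setCitvl.
  rewrite probability_setC// -[X in measurable X]setTI.
  exact: measurable_coord_rV.
Qed.

End strata.
(** * Joint law of the points of a Latin hypercube sample *)

Section union_bound.
Context d (T : measurableType d) (R : realType) (Pr : probability T R).

Lemma probability_bigsetU_le (I : Type) (s : seq I) (F : I -> set T) :
  (forall i, measurable (F i)) ->
  fine (Pr (\big[setU/set0]_(i <- s) F i)) <= \sum_(i <- s) fine (Pr (F i)).
Proof.
move=> mF; elim: s => [|i s IH]; first by rewrite !big_nil measure0.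
have mU : measurable (\big[setU/set0]_(i <- s) F i).
  by apply: bigsetU_measurable => k _.
rewrite !big_cons; apply: le_trans (lerD (lexx _) IH).
rewrite -lee_fin EFinD !fineK ?fin_num_measure//; last exact: measurableU.
exact: measureU2.
Qed.

(** Markov's inequality for the number of events [E i] that occur. *)
Lemma counting_markov (I : finType) (E : I -> set T) (W : set T) (m : R) :
  (forall i, measurable (E i)) -> measurable W -> 0 <= m ->
  (forall w, W w -> m <= \sum_i \1_(E i) w) ->
  m * fine (Pr W) <= \sum_i fine (Pr (E i)).
Proof.
move=> mE mW m0 Wm.
rewrite -lee_fin EFinM fineK ?fin_num_measure// -sumEFin.
rewrite [leRHS](eq_bigr (fun i => Pr (E i))); last first.
  by move=> i _; rewrite fineK// fin_num_measure.
rewrite -[X in Pr X](setIT W) -(integral_indic Pr measurableT mW).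
rewrite -ge0_integralZl//; last by apply/measurable_EFinP; exact: measurable_indic.
rewrite (eq_bigr (fun i => \int[Pr]_w (\1_(E i) w)%:E))%E; last first.
  by move=> i _; rewrite integral_indic// setIT.
rewrite -ge0_integral_sum//; last first.
  by move=> i; apply/measurable_EFinP; exact: measurable_indic.
apply: ge0_le_integral => //.
- by move=> w _; rewrite -EFinM lee_fin mulr_ge0.
- by apply/measurable_EFinP; apply: measurable_funM => //; exact: measurable_indic.
- by apply: emeasurable_sum => i; apply/measurable_EFinP; exact: measurable_indic.
- move=> w _; rewrite -EFinM sumEFin lee_fin indicE.
  case: (boolP (w \in W)) => [|_]; first by rewrite inE mulr1 => /Wm.
  by rewrite mulr0 sumr_ge0.
Qed.

End union_bound.

Lemma bigsetI_bigcap (I : finType) T (F : I -> set T) :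
  \big[setI/setT]_i F i = \bigcap_i F i.
Proof.
rewrite -bigcap_seq; apply/seteqP; split=> x Fx i // _; apply: Fx => //=.
exact: mem_index_enum.
Qed.

Lemma independent_box (R : realType) d (P : probability (borel_rV R d) R) :
  mutually_independent P
    (fun j : 'I_d => preimage_set_system setT (@coord_rV R d j) measurable) ->
  forall B : 'I_d -> set R, (forall j, measurable (B j)) ->
    P (box B) = (\prod_(j < d) P (coord_rV j @^-1` B j))%E.
Proof.
move=> indep B mB.
have <- := indep (index_enum 'I_d) (fun j => coord_rV j @^-1` B j).
- by rewrite bigcap_seq bigsetI_bigcap -box_bigcap.
- exact: index_enum_uniq.
- by move=> j _; exists (B j) => //; rewrite setTI.
Qed.

Section latin_hypercube_sample.
Context (R : realType) (d n : nat) (P : probability (borel_rV R d) R).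
Context (Finv : 'I_d -> R -> R).
Context dO (Omega : measurableType dO) (Pr : probability Omega R).
Variables (u : 'I_d -> 'I_n -> {RV Pr >-> R}) (sigma : 'I_d -> Omega -> 'S_n).

(** Independence of the sources of randomness of one sample, on product events;
    arbitrary sets of permutations are allowed so that taking the full set leaves
    the draws alone. *)
Definition lhs_independent := forall (A : 'I_d -> 'I_n -> set R)
    (E : 'I_d -> set 'S_n), (forall j i, measurable (A j i)) ->
  fine (Pr (\big[setI/setT]_(j < d) \big[setI/setT]_(i < n) (u j i @^-1` A j i)
    `&` \big[setI/setT]_(j < d) (sigma j @^-1` E j))) =
  (\prod_(j < d) \prod_(i < n) fine (Pr (u j i @^-1` A j i))) *
  \prod_(j < d) fine (Pr (sigma j @^-1` E j)).

Hypothesis n_gt0 : (0 < n)%N.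
Hypothesis indep_components : mutually_independent P
  (fun j : 'I_d => preimage_set_system setT (@coord_rV R d j) measurable).
Hypothesis Finv_inv : forall j, inverse_cdf P j (Finv j).
Hypothesis u_strata : forall j i, stratified_draw i (u j i).
Hypothesis sigma_unif : forall j, uniform_permutation Pr (sigma j).
Hypothesis indep : lhs_independent.

Let u01 j i w : 0 < u j i w < 1.
Proof. exact: stratified_draw01 (u_strata j i) w. Qed.

Let mQu j i : measurable_fun setT (Finv j \o u j i).
Proof. exact: (measurable_quantile (Finv_inv j)). Qed.

Let cell := {ffun 'I_d -> 'I_n}.

(** A cell picks one stratum per coordinate; given the permutations, every sample
    point is the point of some cell. *)
Definition cell_point (c : cell) (w : Omega) : borel_rV R d :=
  \row_j Finv j (u j (c j) w).

Let measurable_cell_point c : measurable_fun setT (cell_point c).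
Proof.
apply: measurable_fun_rV => j.
by apply: eq_measurable_fun (mQu j (c j)) => w _; rewrite mxE.
Qed.

HB.instance Definition _ c := isMeasurableFun.Build _ _ _ _ (cell_point c)
  (measurable_cell_point c).

Let mcell c A : measurable A -> measurable (cell_point c @^-1` A).
Proof. by move=> mA; rewrite -[X in measurable X]setTI; exact: measurable_cell_point. Qed.

Let msigma j (E : set 'S_n) : measurable (sigma j @^-1` E).
Proof.
have -> : sigma j @^-1` E = \bigcup_(s in E) (sigma j @^-1` [set s]).
  by apply/seteqP; split=> [w Ew|w [s Es /= ->]] //; exists (sigma j w).
by apply: fin_bigcup_measurable; [exact: finite_finset|move=> s _; exact: (sigma_unif j s).1].
Qed.

Let pre j (B : set R) : set R := `]0, 1[%classic `&` Finv j @^-1` B.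

Let mpre j B : measurable B -> measurable (pre j B).
Proof. by move=> mB; exact: (measurable_quantile01 (Finv_inv j)). Qed.

Let preE j i B : u j i @^-1` pre j B = (Finv j \o u j i) @^-1` B.
Proof.
apply/seteqP; split=> w; rewrite /pre /= in_itv/=; first by case.
by split=> //; exact: u01.
Qed.

Let cell_point_box c (B : 'I_d -> set R) : cell_point c @^-1` box B =
  \big[setI/setT]_(j < d) ((Finv j \o u j (c j)) @^-1` B j).
Proof.
rewrite bigsetI_bigcap; apply/seteqP; split=> w /=.
  by move=> cB j _ /=; have := cB j; rewrite mxE.
by move=> cB j; rewrite mxE; exact: (cB j).
Qed.

Lemma cell_point_law_box c (B : 'I_d -> set R) : (forall j, measurable (B j)) ->
  fine (Pr (cell_point c @^-1` box B)) =
  \prod_(j < d) fine (Pr ((Finv j \o u j (c j)) @^-1` B j)).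
Proof.
move=> mB.
pose A j i := if i == c j then pre j (B j) else setT.
have := indep (A := A) (fun=> setT).
rewrite [X in _ `&` X]big1 ?setIT; last by move=> j _; rewrite preimage_setT.
rewrite [X in _ * X]big1 ?mulr1; last first.
  by move=> j _; rewrite preimage_setT probability_setT.
have -> : \big[setI/setT]_(j < d) \big[setI/setT]_(i < n) (u j i @^-1` A j i) =
    cell_point c @^-1` box B.
  rewrite cell_point_box; apply: eq_bigr => j _.
  rewrite (bigD1 (c j))//= /A eqxx preE big1 ?setIT// => i /negbTE ->.
  by rewrite preimage_setT.
have -> : \prod_(j < d) \prod_(i < n) fine (Pr (u j i @^-1` A j i)) =
    \prod_(j < d) fine (Pr ((Finv j \o u j (c j)) @^-1` B j)).
  apply: eq_bigr => j _.
  rewrite (bigD1 (c j))//= /A eqxx preE big1 ?mulr1// => i /negbTE ->.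
  by rewrite preimage_setT probability_setT.
by apply=> j i; rewrite /A; case: ifP => // _; exact: mpre.
Qed.

(** The mixture of the cells is [P]: on a box the sum over the cells factors into
    one sum over the strata for each coordinate. *)
Lemma sum_cell_point_law A : measurable A ->
  \sum_c fine (Pr (cell_point c @^-1` A)) = n%:R ^+ d * fine (P A).
Proof.
move=> mA.
pose m1 c : {measure set (borel_rV R d) -> \bar R} := distribution Pr (cell_point c).
pose m2 : {measure set (borel_rV R d) -> \bar R} :=
  mscale (NngNum (exprn_ge0 d (ler0n R n))) P.
suff : (\sum_c m1 c A = m2 A)%E.
  rewrite /m1 /m2 /= /mscale/= => /(congr1 fine).
  rewrite fineM ?fin_num_measure// => <-.
  rewrite sum_fine// => c _; apply: fin_num_measure; exact: mcell.
apply: (@sum_measure_unique _ (borel_rV R d) R _ [ffun=> Ordinal n_gt0]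
  (@measurable_boxes R d) (fun=> setT) (@borel_rVE R d)
  (@measurable_boxesI R d)) => //.
- by move=> _; exact: measurable_boxesT.
- by rewrite bigcup_const//; exists 0%N.
- by move=> _; rewrite /m2 /= /mscale/= probability_setT mule1 ltry.
move=> _ [B mB <-].
have mBox : measurable (box B : set (borel_rV R d)) by exact: measurable_box.
have mcB c : measurable (cell_point c @^-1` box B) by exact: mcell.
have mcoord j : measurable (@coord_rV R d j @^-1` B j).
  by rewrite -[X in measurable X]setTI; exact: measurable_coord_rV.
rewrite /m1 /m2 /= /mscale/= /distribution/= /pushforward/=.
rewrite (eq_bigr (fun c : cell =>
    (\prod_(j < d) fine (Pr ((Finv j \o u j (c j)) @^-1` B j)))%:E)); last first.
  by move=> c _; rewrite -cell_point_law_box// fineK// fin_num_measure.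
rewrite sumEFin -(bigA_distr_bigA (fun j i =>
  fine (Pr ((Finv j \o u j i) @^-1` B j)))).
rewrite (eq_bigr (fun j : 'I_d => n%:R * fine (P (coord_rV j @^-1` B j)))); last first.
  move=> j _; apply: EFin_inj; rewrite -sumEFin EFinM fineK ?fin_num_measure//.
  rewrite -(sum_stratified_quantile (Finv_inv j) n_gt0 (u_strata j))//.
  apply: eq_bigr => i _; rewrite fineK// fin_num_measure//.
  by rewrite -[X in measurable X]setTI; exact: mQu.
rewrite big_split/= prodr_const card_ord EFinM; congr (_ * _)%E.
rewrite independent_box// -prodEFin; apply: eq_bigr => j _.
by rewrite fineK// fin_num_measure.
Qed.

Let perm_event (s : {ffun 'I_d -> 'S_n}) : set Omega :=
  \big[setI/setT]_(j < d) (sigma j @^-1` [set s j]).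

Let slice (s : {ffun 'I_d -> 'S_n}) (i : 'I_n) : cell := [ffun j => s j i].

Let measurable_perm_event s : measurable (perm_event s).
Proof. by apply: bigsetI_measurable => j _; exact: msigma. Qed.

(** Given the permutations, distinct sample points use disjoint sets of draws. *)
Lemma sample_given_permutations s (A : 'I_n -> set (borel_rV R d)) :
  (forall i, measurable (A i)) ->
  fine (Pr (perm_event s `&`
    \big[setI/setT]_(i < n) (cell_point (slice s i) @^-1` A i))) =
  (n`!%:R^-1) ^+ d * \prod_(i < n) fine (Pr (cell_point (slice s i) @^-1` A i)).
Proof.
apply: rV_independent_family => // B mB.
pose A' j i := pre j (B ((s j)^-1%g i) j).
have mA' j i : measurable (A' j i) by exact: mpre.
have := indep (fun j => [set s j]) mA'; rewrite setIC -/(perm_event s).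
have -> : \big[setI/setT]_(j < d) \big[setI/setT]_(i < n) (u j i @^-1` A' j i) =
    \big[setI/setT]_(i < n) (cell_point (slice s i) @^-1` box (B i)).
  under [RHS]eq_bigr do rewrite cell_point_box.
  rewrite [RHS]exchange_big; apply: eq_bigr => j _ /=.
  rewrite (reindex_inj (@perm_inj _ (s j))); apply: eq_bigr => i _.
  by rewrite /A' permK preE /slice ffunE.
move=> ->; rewrite mulrC; congr (_ * _).
  rewrite (eq_bigr (fun=> n`!%:R^-1)); last first.
    by move=> j _; rewrite (sigma_unif j (s j)).2.
  by rewrite prodr_const card_ord.
under [RHS]eq_bigr do rewrite cell_point_law_box//.
rewrite [RHS]exchange_big; apply: eq_bigr => j _ /=.
rewrite (reindex_inj (@perm_inj _ (s j))); apply: eq_bigr => i _.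
by rewrite /A' permK preE /slice ffunE.
Qed.

Definition lhs_point (i : 'I_n) (w : Omega) : borel_rV R d :=
  lhs_sample Finv (fun j i => u j i w) (fun j => sigma j w) i.

Lemma lhs_pointE i w : lhs_point i w = cell_point [ffun j => sigma j w i] w.
Proof. by apply/rowP => j; rewrite !mxE ffunE. Qed.

Let all_in_union (A : 'I_n -> set (borel_rV R d)) :
  \bigcap_i (lhs_point i @^-1` A i) =
  \big[setU/set0]_s (perm_event s `&`
    \big[setI/setT]_(i < n) (cell_point (slice s i) @^-1` A i)).
Proof.
rewrite -bigcup_seq; apply/seteqP; split=> [w Aw|w [s _ []]].
  exists [ffun j => sigma j w]; first exact: mem_index_enum.
  split; rewrite ?/perm_event bigsetI_bigcap => i _ /=; first by rewrite ffunE.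
  have := Aw i I; rewrite /= lhs_pointE; congr (A i (cell_point _ _)).
  by apply/ffunP => j; rewrite !ffunE.
rewrite /perm_event !bigsetI_bigcap => sw cw i _.
have := cw i I; rewrite /= lhs_pointE; congr (A i (cell_point _ _)).
by apply/ffunP => j; rewrite !ffunE; have /= -> := sw j I.
Qed.

Let measurable_piece (A : 'I_n -> set (borel_rV R d)) s :
  (forall i, measurable (A i)) ->
  measurable (perm_event s `&`
    \big[setI/setT]_(i < n) (cell_point (slice s i) @^-1` A i)).
Proof.
move=> mA; apply: measurableI => //.
by apply: bigsetI_measurable => i _; exact: mcell.
Qed.

Lemma measurable_all_in (A : 'I_n -> set (borel_rV R d)) :
  (forall i, measurable (A i)) ->
  measurable (\bigcap_i (lhs_point i @^-1` A i)).
Proof.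
move=> mA; rewrite all_in_union; apply: bigsetU_measurable => s _.
exact: measurable_piece.
Qed.

Lemma measurable_lhs_point i : measurable_fun setT (lhs_point i).
Proof.
move=> _ A mA; rewrite setTI.
(* The other points are left unconstrained. *)
pose A' i' := if i' == i then A else setT.
have -> : lhs_point i @^-1` A = \bigcap_i' (lhs_point i' @^-1` A' i').
  apply/seteqP; split=> [w Aw i' _|w /(_ i I)]; rewrite /A' /= ?eqxx//.
  by case: eqP => [->|].
by apply: measurable_all_in => i'; rewrite /A'; case: ifP.
Qed.

(** In other words, [k] sample points have a joint law of density at most
    (n ^ k / n ^_ k) ^ d with respect to [k] independent points of law [P].
    Summing the conditional probabilities over all permutations, each [k]-tuple of
    cells is met by at most ((n - k)!) ^ d choices of the permutations. *)
Lemma lhs_all_in_le k (iota : 'I_k -> 'I_n) (A : set (borel_rV R d)) :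
  injective iota -> measurable A ->
  fine (Pr (\bigcap_i (lhs_point (iota i) @^-1` A))) <=
  (n`!%:R^-1) ^+ d * ((n - k)`!%:R ^+ d * (n%:R ^+ d * fine (P A)) ^+ k).
Proof.
move=> iota_inj mA.
pose J := [set iota i | i : 'I_k]%SET.
pose A' i := if i \in J then A else setT.
have mA' i : measurable (A' i) by rewrite /A'; case: ifP.
have -> : \bigcap_i (lhs_point (iota i) @^-1` A) =
    \bigcap_i (lhs_point i @^-1` A' i).
  apply/seteqP; split=> w Aw i _; rewrite /= /A'.
    by case: ifPn => // /imsetP[i' _ ->]; exact: Aw.
  by have := Aw (iota i) I; rewrite /= /A' imset_f.
rewrite all_in_union; apply: (le_trans (probability_bigsetU_le _ _ _)).
  by move=> s; exact: measurable_piece.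
rewrite -(sum_cell_point_law mA).
under eq_bigr do rewrite sample_given_permutations//.
rewrite -mulr_sumr ler_wpM2l ?exprn_ge0 ?invr_ge0//.
pose q (c : cell) := fine (Pr (cell_point c @^-1` A)).
rewrite -/(\sum_c q c) (le_trans _ (sum_perm_prod_le iota_inj _))//; last first.
  by move=> c; exact: fine_ge0.
rewrite le_eqVlt; apply/orP; left; apply/eqP; apply: eq_bigr => s _.
rewrite (bigID (mem J))/= [X in _ * X]big1 ?mulr1; last first.
  by move=> i /negbTE iJ; rewrite /A' iJ preimage_setT probability_setT.
rewrite big_imset/=; last by move=> ? ? _ _; exact: iota_inj.
apply: eq_bigr => i _; rewrite /A' imset_f//.
Qed.

End latin_hypercube_sample.
(** * Concentration of the number of points in a set *)

Section tail_arithmetic.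
Context (R : realType).

Lemma ffact_lower n k : ((n - k) ^ k <= n ^_ k)%N.
Proof.
elim: k => [|k IH]; first by rewrite ffactn0.
rewrite ffactnSr expnSr leq_mul//; last by rewrite leq_sub2l.
case: k IH => [//|k] IH; apply: leq_trans IH.
by rewrite leq_exp2r// leq_sub2l.
Qed.

Lemma ffact_upper n k : (n ^_ k <= n ^ k)%N.
Proof.
elim: k => [|k IH]; first by rewrite ffactn0.
by rewrite ffactnSr expnSr leq_mul// leq_subr.
Qed.

Lemma bernoulli_le d (b : R) : 0 <= b <= 1 -> 1 - d%:R * b <= (1 - b) ^+ d.
Proof.
move=> /andP[b0 b1]; elim: d => [|d IH]; first by rewrite mul0r subr0 expr0.
have d0 : 0 <= d%:R :> R by [].
rewrite exprS (le_trans _ (ler_wpM2l _ IH)) ?subr_ge0//.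
rewrite -natr1; nra.
Qed.

(** With [b] = k / n, the left side over the right side is, up to the factor
    1 + t / 2, the cost of one more point in the bound of the factorial moment. *)
Lemma tail_ratio d (p t b : R) : 0 <= p <= 1 -> 0 < t <= 1 -> 0 <= b ->
  (2 * (2 * d%:R + 1)) * b <= t ->
  p * (1 + t / 2) <= (p + t - b) * (1 - b) ^+ d.
Proof.
move=> /andP[p0 p1] /andP[t0 t1] b0 bt.
have d0 : 0 <= d%:R :> R by [].
have db0 : 0 <= d%:R * b by rewrite mulr_ge0.
have b1 : 0 <= b <= 1 by rewrite b0/=; lra.
apply: (@le_trans _ _ ((p + t - b) * (1 - d%:R * b))); last first.
  by rewrite ler_wpM2l ?bernoulli_le//; lra.
move: db0 bt; set D := d%:R * b => D0.
have -> : 2 * (2 * d%:R + 1) * b = 4 * D + 2 * b by rewrite /D; ring.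
move=> bt.
have Dp : D * p <= D by rewrite ler_piMr.
have Dt : D * t <= D by rewrite ler_piMr.
have Db : 0 <= D * b by rewrite mulr_ge0.
have pt : p * t <= t by rewrite ler_piMl// ltW.
have -> : p * (1 + t / 2) = p + (p * t) / 2 by lra.
have -> : (p + t - b) * (1 - D) = p + t - b - D * p - D * t + D * b by ring.
lra.
Qed.

End tail_arithmetic.

Section concentration.
Context (R : realType) (d n : nat) (P : probability (borel_rV R d) R).
Context (Finv : 'I_d -> R -> R).
Context dO (Omega : measurableType dO) (Pr : probability Omega R).
Variables (u : 'I_d -> 'I_n -> {RV Pr >-> R}) (sigma : 'I_d -> Omega -> 'S_n).
Hypothesis n_gt0 : (0 < n)%N.
Hypothesis indep_components : mutually_independent P
  (fun j : 'I_d => preimage_set_system setT (@coord_rV R d j) measurable).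
Hypothesis Finv_inv : forall j, inverse_cdf P j (Finv j).
Hypothesis u_strata : forall j i, stratified_draw i (u j i).
Hypothesis sigma_unif : forall j, uniform_permutation Pr (sigma j).
Hypothesis indep : lhs_independent u sigma.

Let point := lhs_point Finv u sigma.

Let mpoint i A : measurable A -> measurable (point i @^-1` A).
Proof.
move=> mA; rewrite -[X in measurable X]setTI.
exact: (measurable_lhs_point Finv_inv u_strata sigma_unif).
Qed.

Definition hits (A : set 'rV[R]_d) (s : 'I_n -> 'rV[R]_d) : R :=
  \sum_(i < n) \1_A (s i).

Lemma measurable_hits (A : set (borel_rV R d)) : measurable A ->
  measurable_fun setT (fun w => hits A (fun i => point i w)).
Proof.
move=> mA; apply: measurable_sum => i.
by apply: (measurable_indic (U := point i @^-1` A)); exact: mpoint.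
Qed.

(** The number of ordered [k]-tuples of distinct sample points in [A] is the
    falling factorial of the number of hits, so it is at least
    (n * (P(A) + t) - k) ^ k on the event; its expectation is nearly
    (n * P(A)) ^ k when [k] is a small fraction of [n].  Markov's inequality
    concludes. *)
Lemma hits_tail (A : set (borel_rV R d)) (t : R) k : measurable A ->
  0 < t <= 1 -> 2 * (2 * d%:R + 1) * k%:R <= t * n%:R ->
  fine (Pr [set w | n%:R * (fine (P A) + t) <= hits A (fun i => point i w)]) <=
  (1 + t / 2)^-1 ^+ k.
Proof.
move=> mA /andP[t0 t1] kn; set W := [set w | _].
have d0 : 0 <= d%:R :> R by [].
have N0 : 0 < n%:R :> R by rewrite ltr0n.
set p := fine (P A).
have p01 : 0 <= p <= 1.
  by rewrite fine_ge0//= -lee_fin fineK ?fin_num_measure// probability_le1.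
have k0 : 0 <= k%:R :> R by [].
have kt : 2 * k%:R <= t * n%:R.
  by apply: le_trans kn; rewrite ler_wpM2r//; lra.
have tn : t * n%:R <= n%:R by rewrite ler_piMl// ltW.
have k_lt_n : k%:R < n%:R :> R by lra.
have kn' : (k <= n)%N by rewrite -(ler_nat R) ltW.
have mW : measurable W.
  have -> : W = (fun w => hits A (fun i => point i w)) @^-1`
      `[n%:R * (p + t), +oo[%classic.
    by apply/seteqP; split=> w; rewrite /W /= in_itv/= andbT.
  by rewrite -[X in measurable X]setTI; exact: measurable_hits.
pose E (iota : {ffun 'I_k -> 'I_n}) : set Omega :=
  if injectiveb iota then \bigcap_i (point (iota i) @^-1` A) else set0.
have mE iota : measurable (E iota).
  rewrite /E; case: ifP => // _; apply: fin_bigcap_measurable => [|i _].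
    exact: finite_finset.
  exact: mpoint.
have M0 : 0 <= n%:R * (p + t) - k%:R.
  rewrite mulrDr; have : 0 <= n%:R * p by rewrite mulr_ge0//; case/andP: p01.
  by move: kt; rewrite mulrC; lra.
have count w : W w -> (n%:R * (p + t) - k%:R) ^+ k <= \sum_iota \1_(E iota) w.
  rewrite /W/= /hits.
  pose B := [set i | `[< A (point i w) >]]%SET.
  have -> : \sum_(i < n) (\1_A (point i w) : R) = #|B|%:R.
    rewrite -sum1_card natr_sum [RHS]big_mkcond; apply: eq_bigr => i _.
    rewrite indicE inE; case: asboolP => [Ai|nAi]; first by rewrite mem_set.
    by rewrite memNset.
  move=> WB; apply: (@le_trans _ _ (#|B| ^_ k)%:R).
    apply: (@le_trans _ _ ((#|B| - k) ^ k)%:R); last first.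
      by rewrite ler_nat ffact_lower.
    rewrite natrX; apply: lerXn2r; rewrite ?nnegrE//.
    rewrite lerBlDr (le_trans WB)// -natrD ler_nat.
    by rewrite addnC -leq_subLR.
  have := card_inj_ffuns_on 'I_k (mem B); rewrite card_ord => <-.
  rewrite -sum1_card natr_sum big_mkcond; apply: ler_sum => iota _.
  rewrite inE; case: ifP => // /andP[/ffun_onP iB iota_inj].
  rewrite indicE mem_set// /E iota_inj => i _.
  by have := iB i; rewrite inE => /asboolP.
have := counting_markov Pr mE mW (exprn_ge0 k M0) count.
set N : R := n%:R; set K : R := k%:R; set M := N * (p + t) - K.
have p0 : 0 <= p by case/andP: p01.
have N0' : 0 <= N by rewrite /N.
pose b := K / N.
have b0 : 0 <= b by rewrite divr_ge0// ltW.
have bN : b * N = K by rewrite divfK// gt_eqF.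
have b1 : b < 1 by rewrite ltr_pdivrMr// mul1r.
have NK : N - K = N * (1 - b) by rewrite -bN; ring.
have ME : M = N * (p + t - b) by rewrite /M -bN; ring.
have Mgt0 : 0 < M.
  have : 0 <= N * p by rewrite mulr_ge0.
  have : 0 < t * N by rewrite mulr_gt0.
  by move: kt; rewrite /M mulrDr (mulrC t) -/K -/N; lra.
(* [r] bounds the expected number of [k]-tuples by its [k]-th power. *)
pose r := N * p * (1 - b) ^- d.
have r0 : 0 <= r.
  by rewrite /r mulr_ge0 ?invr_ge0 ?exprn_ge0 ?mulr_ge0 ?subr_ge0// ltW.
have rM : r <= (1 + t / 2)^-1 * M.
  rewrite ler_pdivlMl; last by lra.
  rewrite /r mulrA ler_pdivrMr ?exprn_gt0 ?subr_gt0// ME -mulrA.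
  have -> : (1 + t / 2) * (N * p) = N * (p * (1 + t / 2)) by ring.
  rewrite ler_wpM2l// tail_ratio//; first by rewrite t0.
  by rewrite -(ler_pM2r N0) -/N -[_ * b * N]mulrA bN.
move=> markov; rewrite -(ler_pM2l (exprn_gt0 k Mgt0)) (le_trans markov)//.
rewrite mulrC -exprMn; apply: (@le_trans _ _ (r ^+ k)); last first.
  by apply: lerXn2r; rewrite ?nnegrE// mulr_ge0 ?invr_ge0 ?ltW//; lra.
pose bound := n`!%:R^-1 ^+ d * ((n - k)`!%:R ^+ d * (N ^+ d * p) ^+ k).
apply: (@le_trans _ _ ((n ^_ k)%:R * bound)).
  have := card_inj_ffuns 'I_k 'I_n; rewrite !card_ord => <-.
  rewrite -sum1_card natr_sum mulr_suml [leRHS]big_mkcond; apply: ler_sum => iota _.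
  rewrite /E inE; case: ifPn => [/injectiveP iota_inj|_]; last by rewrite measure0.
  by rewrite mul1r; apply: lhs_all_in_le.
have F0 : 0 < (n ^_ k)%:R :> R by rewrite ltr0n ffact_gt0.
have G0 : 0 < (n - k)`!%:R :> R by rewrite ltr0n fact_gt0.
have boundE : bound = (n ^_ k)%:R ^- d * (N ^+ d * p) ^+ k.
  rewrite /bound mulrA; congr (_ * _).
  rewrite -exprMn -exprVn -(ffact_fact kn') natrM; congr (_ ^+ d).
  by rewrite invfM -mulrA mulVf ?mulr1// gt_eqF.
have NK0 : 0 < N - K by rewrite subr_gt0.
have Flow : (N - K) ^+ k <= (n ^_ k)%:R.
  by rewrite -natrB// -natrX ler_nat ffact_lower.
have Fup : (n ^_ k)%:R <= N ^+ k by rewrite -natrX ler_nat ffact_upper.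
have -> : r ^+ k = N ^+ k * (((N - K) ^+ k) ^- d * (N ^+ d * p) ^+ k).
  rewrite exprAC -exprVn -!exprMn; congr (_ ^+ k).
  rewrite /r NK exprMn; field.
  by rewrite !expf_neq0 ?gt_eqF ?subr_gt0.
rewrite boundE ler_pM//.
  by rewrite mulr_ge0 ?invr_ge0 ?exprn_ge0 ?mulr_ge0 ?exprn_ge0.
rewrite ler_wpM2r ?exprn_ge0 ?mulr_ge0 ?exprn_ge0//.
have NKk : 0 < (N - K) ^+ k by exact: exprn_gt0.
rewrite lef_pV2 ?posrE; [|exact: exprn_gt0|exact: exprn_gt0].
by apply: lerXn2r; rewrite ?nnegrE// ltW.
Qed.

End concentration.
(** * Continuous functions on a compact set of decisions *)

Section compact_sets.
Context (R : realType) (dx : nat) (X : set 'rV[R]_dx).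
Hypothesis X_compact : compact X.

Lemma compact_net (e : R) : 0 < e ->
  exists s : seq 'rV[R]_dx, (forall y, y \in s -> X y) /\
    forall x, X x -> exists2 y, y \in s & ball y e x.
Proof.
move=> e0; move: X_compact; rewrite compact_cover => cX.
have [|x Xx|D DX XD] := cX _ X (fun y => (ball y e)^°).
- by move=> y _; exact: open_interior.
- by exists x => //; exact: (nbhsx_ballx x).
exists (finmap.enum_fset D); split=> [y yD|x /XD[y yD yx]].
  by apply: set_mem; exact: DX.
by exists y => //; exact: interior_subset yx.
Qed.

Lemma within_continuousP (g : 'rV[R]_dx -> R) : {within X, continuous g} ->
  forall x e, X x -> 0 < e -> exists2 r, 0 < r &
    forall y, X y -> ball x r y -> `|g x - g y| < e.
Proof.
move=> /subspace_continuousP gX x e Xx e0.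
have /cvgrPdist_lt/(_ e e0) := gX x Xx.
rewrite near_withinE => /nbhs_ballP[r r0 xr].
by exists r => // y Xy xy; exact: xr.
Qed.

Lemma heine_cantor (g : 'rV[R]_dx -> R) (eta : R) : {within X, continuous g} ->
  0 < eta -> exists q : nat, forall x y, X x -> X y ->
    ball x q.+1%:R^-1 y -> `|g x - g y| <= eta.
Proof.
move=> gX eta0; have := X_compact; rewrite compact_near_coveringP.
move=> /(_ nat \oo (fun q x => X x -> forall y, X y ->
  ball x q.+1%:R^-1 y -> `|g x - g y| <= eta)).
case=> [x Xx|N _ HN]; last first.
  by exists N => x y Xx Xy; apply: (HN N) => //=.
have eta2 : 0 < eta / 2 by rewrite divr_gt0.
have [r r0 xr] := within_continuousP gX Xx eta2.
have r2 : 0 < r / 2 by rewrite divr_gt0.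
near=> x' q => /= Xx' y Xy x'y.
have xx' : ball x (r / 2) x' by near: x'; exact: (nbhsx_ballx x).
have q_le : q.+1%:R^-1 <= r / 2 
  by apply/ltW; near: q; exact: (near_infty_natSinv_lt (PosNum r2)).
have xy : ball x r y.
  by rewrite [r]splitr; apply: (ball_triangle xx'); exact: le_ball x'y.
rewrite (le_trans (ler_distD (g x) _ _))// (splitr eta) lerD//.
  by rewrite distrC ltW// xr//; apply: le_ball xx'; rewrite ler_pdivrMr// ler_pMr// ler1n.
by rewrite ltW// xr.
Unshelve. all: by end_near. Qed.

(** The points of the finite nets of mesh 1 / (q + 1), enumerated through an
    encoding of pairs (net, position). *)
Lemma compact_dense_sequence : X !=set0 ->
  exists e : nat -> 'rV[R]_dx, (forall k, X (e k)) /\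
    forall x r, X x -> 0 < r -> exists k, ball x r (e k).
Proof.
move=> [x0 Xx0].
have /choice[s sP] (q : nat) : exists s : seq 'rV[R]_dx,
    (forall y, y \in s -> X y) /\
    forall x, X x -> exists2 y, y \in s & ball y q.+1%:R^-1 x.
  by apply: compact_net; rewrite invr_gt0.
pose e k := if choice.unpickle k is Some (q, i) then nth x0 (s q) i else x0.
exists e; split=> [k|x r Xx r0].
  rewrite /e; case: choice.unpickle => [[q i]|//].
  have [si|si] := ltnP i (size (s q)); last by rewrite nth_default.
  by apply: (sP q).1; exact: mem_nth.
have [q] := ltr_add_invr r0; rewrite add0r => qr.
have [y ys yx] := (sP q).2 x Xx.
exists (choice.pickle (q, index y (s q))).
rewrite /e choice.pickleK nth_index//; apply: ball_sym.
by apply: le_ball yx; exact: ltW.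
Qed.

End compact_sets.
(** * Averages of a bounded function from frequencies of sets *)

Section layer_cake.
Context (R : realType).

(** The layer-cake approximation of [v] with steps of height [delta]. *)
Definition staircase (delta : R) L (v : R) : R :=
  \sum_(l < L) delta * (l.+1%:R * delta <= v)%R%:R.

Lemma staircase_bounds (delta v : R) L : 0 < delta -> 0 <= v ->
  v <= L%:R * delta -> staircase delta L v <= v <= delta + staircase delta L v.
Proof.
move=> delta0 v0 vL.
suff [full part] : (L%:R * delta <= v -> staircase delta L v = L%:R * delta) /\
    (v < L%:R * delta -> staircase delta L v <= v <= delta + staircase delta L v).
  have [/part//|Lv] := ltP v (L%:R * delta).
  by rewrite full//; apply/andP; split=> //; lra.
elim: {vL} L => [|L [full part]].
  rewrite mul0r /staircase big_ord0; split=> // v_lt0.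
  by move: (lt_le_trans v_lt0 v0); rewrite ltxx.
have SLE : L.+1%:R * delta = L%:R * delta + delta by rewrite -natr1 mulrDl mul1r.
rewrite {1 2 3}/staircase !big_ord_recr/= -/(staircase delta L v).
split=> [vL|vL].
  by rewrite vL mulr1 full ?SLE//; move: vL; rewrite SLE; lra.
have /negbTE -> : ~~ (L.+1%:R * delta <= v) by rewrite -ltNge.
rewrite mulr0 addr0.
have [/part//|Lv] := ltP v (L%:R * delta).
by rewrite full//; apply/andP; split=> //; move: vL; rewrite SLE; lra.
Qed.

Context (d : nat) (P : probability (borel_rV R d) R).
Local Notation S := (law_support P).

Let mS : measurable (S : set (borel_rV R d)).
Proof. exact: measurable_law_support. Qed.

Lemma bounded_integrable (phi : borel_rV R d -> R) C :
  measurable_fun (S : set (borel_rV R d)) phi ->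
  (forall xi, S xi -> `|phi xi| <= C) ->
  P.-integrable (S : set (borel_rV R d)) (EFin \o phi).
Proof.
move=> mphi phiC; apply: measurable_bounded_integrable => //.
  by rewrite (le_lt_trans (probability_le1 _ mS))// ltry.
exists C; split; first exact: num_real.
by move=> y Cy xi Sxi; rewrite /= (le_trans (phiC _ Sxi))// ltW.
Qed.

Lemma integrable_indic_support (A : set (borel_rV R d)) : measurable A ->
  P.-integrable (S : set (borel_rV R d)) (EFin \o (\1_A : borel_rV R d -> R)).
Proof.
move=> mA; apply: (@bounded_integrable _ 1) => [|xi _].
  by apply: measurable_funTS; exact: measurable_indic.
by rewrite ger0_norm// indicE; case: (_ \in _).
Qed.

Lemma Rintegral_indic_support (A : set (borel_rV R d)) : measurable A ->
  (\int[P]_(xi in S) \1_A xi)%R = fine (P A).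
Proof.
move=> mA; rewrite /Rintegral integral_indic//; congr fine.
apply/eqP; rewrite eq_le measureIl//=.
rewrite (measureDI P mA mS) [X in (X + _)%E](_ : _ = 0%E) ?add0e ?lexx//.
have PSC : P (~` S) = 0%E.
  by rewrite probability_setC// probability_law_support subee.
apply/eqP; rewrite eq_le measure_ge0 andbT -PSC setDE.
by rewrite measureIr//; exact: measurableC.
Qed.

(** Upper bounds suffice: a lower bound for a function is an upper bound for its
    opposite, whose superlevel sets are other test sets. *)
Definition hits_controlled (As : seq (set (borel_rV R d))) (t : R) n
    (s : 'I_n -> 'rV[R]_d) : Prop :=
  forall A, A \in As -> hits A s <= n%:R * (fine (P A) + t).

(** Layer cake: up to [delta], a bounded function is a finite sum of indicators
    of its superlevel sets. *)
Lemma mean_le_test_sets (phi : borel_rV R d -> R) C eta :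
  measurable_fun (S : set (borel_rV R d)) phi ->
  (forall xi, S xi -> `|phi xi| <= C) -> 0 < eta ->
  exists t As, [/\ 0 < t, forall A, A \in As -> measurable A &
    forall t' n (s : 'I_n -> 'rV[R]_d), (0 < n)%N -> t' <= t ->
      (forall i, S (s i)) -> hits_controlled As t' s ->
      n%:R^-1 * \sum_(i < n) phi (s i) <= (\int[P]_(xi in S) phi xi)%R + eta].
Proof.
move=> mphi phiC eta0.
pose delta := eta / 2.
have delta0 : 0 < delta by rewrite divr_gt0.
(* [L] steps of height [delta] cover the range [0, 2 * C] of [phi + C]. *)
pose L := Num.bound (2 * `|C| / delta).
have CL : 2 * `|C| <= L%:R * delta.
  rewrite -ler_pdivrMr//; apply/ltW/archi_boundP.
  by rewrite divr_ge0 ?mulr_ge0// ltW.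
pose A (l : nat) : set (borel_rV R d) :=
  S `&` phi @^-1` `[l.+1%:R * delta - C, +oo[.
have mA l : measurable (A l) by exact: mphi.
have in_cake xi : S xi ->
    staircase delta L (phi xi + C) = \sum_(l < L) delta * \1_(A l) xi.
  move=> Sxi; apply: eq_bigr => l _; rewrite -lerBlDr indicE; congr (_ * _%:R).
  congr nat_of_bool; apply/idP/idP => [H|].
    by apply/mem_set; split=> //=; rewrite in_itv/= andbT.
  by move/set_mem => [_ /=]; rewrite in_itv/= andbT.
have phi_bounds xi : S xi -> \sum_(l < L) delta * \1_(A l) xi <= phi xi + C <=
    delta + \sum_(l < L) delta * \1_(A l) xi.
  move=> Sxi; rewrite -in_cake//; have := phiC _ Sxi.
  rewrite ler_norml => /andP[H1 H2]; apply: staircase_bounds => //; first by lra.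
  by apply: le_trans CL; have := ler_norm C; lra.
pose g k xi := \sum_(l < k) delta * \1_(A l) xi.
have ig k : P.-integrable (S : set (borel_rV R d)) (EFin \o g k) /\
    (\int[P]_(xi in S) g k xi)%R = \sum_(l < k) delta * fine (P (A l)).
  elim: k => [|k [ig IH]].
    have -> : g 0%N = cst 0 by apply/funext => xi; rewrite /g big_ord0.
    rewrite big_ord0; split; last by rewrite Rintegral_cst// mul0r.
    by apply: (@bounded_integrable _ 0) => // xi _; rewrite normr0.
  have -> : g k.+1 = (fun xi => g k xi + delta * \1_(A k) xi).
    by apply/funext => xi; rewrite /g big_ord_recr.
  have iA := integrable_indic_support (mA k).
  have idA : P.-integrable (S : set (borel_rV R d))
      (EFin \o (fun xi => delta * \1_(A k) xi)).
    exact: (integrableZl mS delta iA).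
  split; first exact: (integrableD mS ig idA).
  by rewrite RintegralD// IH RintegralZl// Rintegral_indic_support// big_ord_recr.
have iphi := bounded_integrable mphi phiC.
have iC : P.-integrable (S : set (borel_rV R d)) (EFin \o cst C).
  apply: (@bounded_integrable _ `|C|) => //.
have int_ge : \sum_(l < L) delta * fine (P (A l)) <=
    (\int[P]_(xi in S) phi xi)%R + C.
  have [igL <-] := ig L.
  have -> : C = (\int[P]_(xi in S) (cst C) xi)%R.
    by rewrite Rintegral_cst// [X in fine X](probability_law_support P) mulr1.
  rewrite -RintegralD//; apply: le_Rintegral => //.
    exact: (integrableD mS iphi iC).
  by move=> xi Sxi; have /andP[] := phi_bounds xi Sxi.
(* The slack [t] is paid once per level, [delta] each time. *)
exists (L.+1%:R^-1), [seq A l | l <- iota 0 L]; split.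
- by rewrite invr_gt0.
- by move=> _ /mapP[l _ ->].
move=> t' n s n0 t't sS As.
have N0 : 0 < n%:R :> R by rewrite ltr0n.
rewrite ler_pdivrMl//.
apply: (@le_trans _ _ (\sum_(i < n) (delta - C + \sum_(l < L) delta * \1_(A l) (s i)))).
  by apply: ler_sum => i _; have /andP[_] := phi_bounds _ (sS i); lra.
rewrite big_split/= sumr_const card_ord exchange_big/=.
have As_le (l : 'I_L) : \sum_(i < n) delta * \1_(A l) (s i) <=
    n%:R * (delta * fine (P (A l)) + delta * t').
  rewrite -mulr_sumr -mulrDr mulrCA ler_wpM2l//; first exact: ltW.
  by apply: As; apply/mapP; exists (l : nat) => //; rewrite mem_iota/=.
apply: (@le_trans _ _ ((delta - C) *+ n + \sum_(l < L)
    n%:R * (delta * fine (P (A l)) + delta * t'))).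
  by rewrite lerD2l; apply: ler_sum => l _; exact: As_le.
rewrite -mulr_sumr -[_ *+ n]mulr_natl -mulrDr ler_wpM2l//.
rewrite big_split/= sumr_const card_ord.
have Lt : (delta * t') *+ L <= delta.
  rewrite -mulr_natr -mulrA; apply: ler_piMr; first exact: ltW.
  apply: (@le_trans _ _ (L.+1%:R^-1 * L%:R)); first by rewrite ler_wpM2r.
  by rewrite ler_pdivrMl// mulr1 ler_nat.
have -> : eta = delta + delta by rewrite /delta; lra.
by move: int_ge Lt; lra.
Qed.

End layer_cake.
(** * Uniform law of large numbers *)

Section bounded_program.
Context (R : realType) (dx d : nat) (X : set 'rV[R]_dx).
Context (P : probability (borel_rV R d) R) (f : 'rV[R]_dx -> 'rV[R]_d -> R).
Local Notation S := (law_support P).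
Hypothesis mf : measurable_fun
  ((X : set (borel_rV R dx)) `*` (S : set (borel_rV R d)))
  (fun z : borel_rV R dx * borel_rV R d => f z.1 z.2).
Hypothesis f_cont : {ae P, forall xi, {within X, continuous (fun x => f x xi)}}.
Variable C : R.
Hypothesis f_le : forall x xi, X x -> S xi -> `|f x xi| <= C.
Hypothesis X_neq0 : X !=set0.
Hypothesis X_compact : compact X.

Let mS : measurable (S : set (borel_rV R d)).
Proof. exact: measurable_law_support. Qed.

Lemma measurable_decision_set : measurable (X : set (borel_rV R dx)).
Proof.
by apply: measurable_closed_rV; exact: compact_closed.
Qed.

Lemma measurable_section x : X x ->
  measurable_fun (S : set (borel_rV R d)) (f x : borel_rV R d -> R).
Proof.
move=> Xx.
apply: (measurable_comp _ _ mf (g := fun xi : borel_rV R d => (x : borel_rV R dx, xi))).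
- by apply: measurableX => //; exact: measurable_decision_set.
- by move=> _ [xi Sxi <-].
- by apply: measurable_funTS; exact: pair1_measurable.
Qed.

(** For almost every [xi] the function f(., xi) is uniformly continuous, so the
    sets on which the modulus [eta] is met at scale 1 / (q + 1) increase to an
    almost sure event; one of them is large.  A countable dense subset of [X] makes
    these sets measurable, and continuity extends the bound to all of [X]. *)
Lemma exists_equicontinuous_set (eta : R) : 0 < eta -> exists delta : R,
  exists E : set (borel_rV R d), [/\ 0 < delta, measurable E, E `<=` S,
    fine (P (~` E)) <= eta &
    forall xi x y, E xi -> X x -> X y -> ball x delta y ->
      `|f x xi - f y xi| <= eta].
Proof.
move=> eta0.
have [e [Xe e_dense]] := compact_dense_sequence X_compact X_neq0.
have [N [mN PN subN]] := f_cont.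
pose E q : set (borel_rV R d) := \bigcap_k \bigcap_l
  ((S `\` N) `&` [set xi | ball (e k) q.+1%:R^-1 (e l) ->
     `|f (e k) xi - f (e l) xi| <= eta]).
have mE q : measurable (E q).
  apply: bigcapT_measurable => k; apply: bigcapT_measurable => l.
  have [b|nb] := pselect (ball (e k) q.+1%:R^-1 (e l)); last first.
    rewrite [X in _ `&` X](_ : _ = setT) ?setIT; first exact: measurableD.
    by apply/seteqP; split=> // xi _ /= /nb.
  rewrite setDE -setIA [X in S `&` X]setIC setIA.
  apply: measurableI; last exact: measurableC.
  have -> : S `&` [set xi | ball (e k) q.+1%:R^-1 (e l) ->
      `|f (e k) xi - f (e l) xi| <= eta] =
      S `&` (fun xi => `|f (e k) xi - f (e l) xi|) @^-1` `]-oo, eta].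
    apply/seteqP; split=> xi [Sxi /=]; rewrite in_itv/= => H; split=> //=.
    exact: H.
  have mfe i : measurable_fun (S : set (borel_rV R d)) (f (e i) : borel_rV R d -> R).
    exact: measurable_section.
  have : measurable_fun (S : set (borel_rV R d))
      ((fun xi => `|f (e k) xi - f (e l) xi|) : borel_rV R d -> R).
    apply: measurableT_comp => //; exact: measurable_funB.
  by apply.
have E_nd : nondecreasing_seq E.
  move=> q r qr; rewrite subsetEset => xi Exi k _ l _.
  have [SN H] := Exi k I l I; split=> // b; apply: H; apply: le_ball b.
  by rewrite lef_pV2 ?posrE// ler_nat ltnS.
have E_cover : S `\` N `<=` \bigcup_q E q.
  move=> xi [Sxi Nxi].
  have fxi : {within X, continuous (fun x => f x xi)}.
    by apply: contrapT => H; apply: Nxi; exact: subN.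
  have [q qP] := heine_cantor X_compact fxi eta0.
  by exists q => // k _ l _; split=> // b; apply: qP.
have mUE : measurable (\bigcup_q E q) by exact: bigcupT_measurable.
have PUE : P (\bigcup_q E q) = 1%E.
  apply/eqP; rewrite eq_le probability_le1//=.
  rewrite -(probability_law_support P) (measureDI P mS mN).
  rewrite [X in (_ + X)%E](_ : _ = 0%E) ?adde0.
    by apply: le_measure; rewrite ?inE//; exact: measurableD.
  by apply/eqP; rewrite eq_le measure_ge0 andbT -PN measureIr.
have : P (E q) @[q --> \oo] --> 1%E.
  by rewrite -PUE; exact: nondecreasing_cvg_mu.
move=> /fine_cvgP[_ /cvgrPdist_le/(_ _ eta0)[q _ /(_ q (leqnn q)) /=]] PEq.
(* A third, because both points are first moved to the dense sequence. *)
exists (q.+1%:R^-1 / 3), (E q); split=> //.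
- by move=> xi Exi; have [[]] := Exi 0%N I 0%N I.
- rewrite probability_setC// fineB ?fin_num_measure//=.
  by rewrite (le_trans (ler_norm _)).
move=> xi x y Exi Xx Xy xy.
have [[Sxi Nxi] _] := Exi 0%N I 0%N I.
have fxi : {within X, continuous (fun x => f x xi)}.
  by apply: contrapT => H; apply: Nxi; exact: subN.
set b : R := q.+1%:R^-1 / 3 in xy.
have b0 : 0 < b by rewrite divr_gt0// invr_gt0.
apply/ler_addgt0Pr => c c0.
have c2 : 0 < c / 2 by rewrite divr_gt0.
have [r1 r10 xr] := within_continuousP fxi Xx c2.
have [r2 r20 yr] := within_continuousP fxi Xy c2.
have [k xk] : exists k, ball x (Num.min r1 b) (e k).
  by apply: e_dense; rewrite // lt_min r10.
have [l yl] : exists l, ball y (Num.min r2 b) (e l).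
  by apply: e_dense; rewrite // lt_min r20.
have kl : ball (e k) q.+1%:R^-1 (e l).
  have -> : q.+1%:R^-1 = b + b + b by rewrite /b; set v := _^-1; lra.
  apply: (@ball_triangle _ _ y).
    apply: (@ball_triangle _ _ x) => //; apply: ball_sym.
    by apply: le_ball xk; rewrite ge_min lexx orbT.
  by apply: le_ball yl; rewrite ge_min lexx orbT.
have [_ /(_ kl) fkl] := Exi k I l I.
have fxk : `|f x xi - f (e k) xi| < c / 2.
  by apply: xr => //; apply: le_ball xk; rewrite ge_min lexx.
have fyl : `|f y xi - f (e l) xi| < c / 2.
  by apply: yr => //; apply: le_ball yl; rewrite ge_min lexx.
have -> : f x xi - f y xi = (f x xi - f (e k) xi) + (f (e k) xi - f (e l) xi)
   - (f y xi - f (e l) xi) by ring.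
rewrite (le_trans (ler_normB _ _))// (le_trans (lerD (ler_normD _ _) (lexx _)))//.
lra.
Qed.

Lemma section_integrable x : X x ->
  P.-integrable (S : set (borel_rV R d)) (EFin \o (f x : borel_rV R d -> R)).
Proof.
move=> Xx; apply: (bounded_integrable (measurable_section Xx)) => xi.
exact: f_le.
Qed.

Let C_ge0 : 0 <= C.
Proof.
have [x Xx] := X_neq0; have [xi Sxi] : S !=set0.
  apply/set0P/eqP => S0; have := probability_law_support P.
  by rewrite S0 measure0 => /eqP; rewrite eq_sym onee_eq0.
exact: le_trans (normr_ge0 _) (f_le Xx Sxi).
Qed.

(** Moving a decision by less than [delta] changes both its expectation and its
    sample averages little: the integrand moves by at most [eta] on [E], and by
    at most [2 * C] off [E], which is rarely hit. *)
Section equicontinuous.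
Variables (eta delta : R) (E : set (borel_rV R d)).
Hypotheses (mE : measurable E) (PE : fine (P (~` E)) <= eta) (eta0 : 0 <= eta).
Hypothesis E_equi : forall xi x y, E xi -> X x -> X y -> ball x delta y ->
  `|f x xi - f y xi| <= eta.
Variables (x y : 'rV[R]_dx).
Hypotheses (Xx : X x) (Xy : X y) (xy : ball x delta y).

Let pointwise xi : S xi ->
  `|f x xi - f y xi| <= eta + 2 * C * \1_(~` E) xi.
Proof.
move=> Sxi; have [Exi|nExi] := pselect (E xi).
  rewrite (le_trans (E_equi Exi Xx Xy xy))// lerDl mulr_ge0// mulr_ge0//.
rewrite indicE mem_set// mulr1 (le_trans (ler_normB _ _))//.
have := f_le Xx Sxi; have := f_le Xy Sxi; have := eta0; lra.
Qed.

Lemma Ef_equicontinuous : `|Ef P f x - Ef P f y| <= eta + 2 * C * eta.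
Proof.
have mCE : measurable (~` E) by exact: measurableC.
have ix := section_integrable Xx; have iy := section_integrable Xy.
have ixy : P.-integrable (S : set (borel_rV R d))
    (EFin \o (fun xi : borel_rV R d => f x xi - f y xi)).
  exact: (integrableB mS ix iy).
have i1 : P.-integrable (S : set (borel_rV R d))
    (EFin \o (fun xi : borel_rV R d => eta)).
  by apply: (@bounded_integrable _ _ _ _ `|eta|).
have iE := integrable_indic_support P mCE.
have i2 : P.-integrable (S : set (borel_rV R d))
    (EFin \o (fun xi : borel_rV R d => 2 * C * \1_(~` E) xi)).
  exact: (integrableZl mS (2 * C) iE).
rewrite /Ef -(RintegralB mS ix iy).
apply: (le_trans (le_normr_Rintegral mS ixy)).
have inorm : P.-integrable (S : set (borel_rV R d))
    (EFin \o (fun xi : borel_rV R d => `|f x xi - f y xi|)).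
  exact: (integrable_norm ixy).
apply: (le_trans (le_Rintegral mS inorm (integrableD mS i1 i2) pointwise)).
rewrite (RintegralD mS i1 i2) (RintegralZl _ mS iE) Rintegral_indic_support//.
rewrite Rintegral_cst// [X in _ * fine X + _](probability_law_support P) mulr1.
by rewrite lerD2l ler_wpM2l// mulr_ge0.
Qed.

Lemma mean_equicontinuous n (s : 'I_n -> 'rV[R]_d) t : (0 < n)%N ->
  (forall i, S (s i)) -> hits (~` E) s <= n%:R * (fine (P (~` E)) + t) ->
  `|n%:R^-1 * \sum_(i < n) f x (s i) - n%:R^-1 * \sum_(i < n) f y (s i)| <=
  eta + 2 * C * (eta + t).
Proof.
move=> n0 sS; rewrite /hits => hitsE.
have N0 : 0 < n%:R :> R by rewrite ltr0n.
rewrite -mulrBr -sumrB normrM ger0_norm ?invr_ge0//.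
rewrite ler_pdivrMl// (le_trans (ler_norm_sum _ _ _))//.
apply: (@le_trans _ _ (\sum_(i < n) (eta + 2 * C * \1_(~` E) (s i)))).
  by apply: ler_sum => i _; exact: pointwise.
rewrite big_split/= sumr_const card_ord -[eta *+ n]mulr_natl [leRHS]mulrDr lerD2l -mulr_sumr.
rewrite mulrCA ler_wpM2l ?mulr_ge0// (le_trans hitsE)// ler_wpM2l//.
by rewrite lerD2r.
Qed.

End equicontinuous.

Lemma Ef_uniformly_continuous eta : 0 < eta -> exists2 delta, 0 < delta &
  forall x y, X x -> X y -> ball x delta y -> `|Ef P f x - Ef P f y| <= eta.
Proof.
move=> eta0; pose e := eta / (1 + 2 * C).
have C1 : 0 < 1 + 2 * C by have := C_ge0; lra.
have e0 : 0 < e by rewrite divr_gt0.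
have [delta [E [delta0 mE _ PE EE]]] := exists_equicontinuous_set e0.
exists delta => // x y Xx Xy xy.
rewrite (le_trans (Ef_equicontinuous mE PE (ltW e0) EE Xx Xy xy))//.
have -> : e + 2 * C * e = e * (1 + 2 * C) by ring.
by rewrite divfK// gt_eqF.
Qed.

(** Each function [f y] contributes its own test sets and those of its opposite. *)
Lemma mean_le_test_sets_seq (ys : seq 'rV[R]_dx) eta : 0 < eta ->
  (forall y, y \in ys -> X y) ->
  exists t As, [/\ 0 < t, forall A, A \in As -> measurable A &
    forall t' n (s : 'I_n -> 'rV[R]_d), (0 < n)%N -> t' <= t ->
      (forall i, S (s i)) -> hits_controlled P As t' s ->
      forall y, y \in ys ->
        `|n%:R^-1 * \sum_(i < n) f y (s i) - Ef P f y| <= eta].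
Proof.
move=> eta0; elim: ys => [|y ys IH] ysX.
  by exists 1, [::]; split.
have [|t1 [As1 [t10 mAs1 H1]]] := IH.
  by move=> z zys; apply: ysX; rewrite inE zys orbT.
have Xy : X y by apply: ysX; rewrite inE eqxx.
have my := measurable_section Xy.
have [t2 [As2 [t20 mAs2 H2]]] := mean_le_test_sets my (fun xi => f_le Xy) eta0.
have mNy : measurable_fun (S : set (borel_rV R d))
    ((fun xi => - f y xi) : borel_rV R d -> R) by exact: measurable_funN.
have Ny_le xi : S xi -> `|- f y xi| <= C by rewrite normrN; exact: f_le.
have [t3 [As3 [t30 mAs3 H3]]] := mean_le_test_sets mNy Ny_le eta0.
exists (Num.min t1 (Num.min t2 t3)), (As1 ++ As2 ++ As3).
split=> [|A|t' n s n0 t't sS As].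
- by rewrite !lt_min t10 t20.
- by rewrite !mem_cat => /or3P[/mAs1|/mAs2|/mAs3].
have [t'1 t'2 t'3] : [/\ t' <= t1, t' <= t2 & t' <= t3].
  by move: t't; rewrite !le_min => /and3P[].
move=> z; rewrite inE => /predU1P[->|]; last first.
  have As1' : hits_controlled P As1 t' s.
    by move=> A As1A; apply: As; rewrite mem_cat As1A.
  exact: (H1 t' n s n0 t'1 sS As1').
have := H2 t' n s n0 t'2 sS; have := H3 t' n s n0 t'3 sS.
rewrite sumrN mulrN.
have -> : (\int[P]_(xi in S) - f y xi)%R = - Ef P f y.
  rewrite -mulN1r -(RintegralZl _ mS (section_integrable Xy)).
  by apply: eq_Rintegral => xi _; rewrite mulN1r.
have As2' : hits_controlled P As2 t' s.
  by move=> A As2A; apply: As; rewrite !mem_cat As2A !orbT.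
have As3' : hits_controlled P As3 t' s.
  by move=> A As3A; apply: As; rewrite !mem_cat As3A !orbT.
rewrite -/(Ef P f y) ler_distl => /(_ As3') U3 /(_ As2') U2.
by apply/andP; split=> //; lra.
Qed.

(** A purely deterministic statement on the points [s i]: all the randomness is in
    the frequencies of the test sets, which are those of the points of a finite
    net, together with the complement of the equicontinuity set. *)
Lemma uniform_lln_test_sets eta : 0 < eta ->
  exists t As, [/\ 0 < t <= 1, forall A, A \in As -> measurable A &
    forall n (s : 'I_n -> 'rV[R]_d), (0 < n)%N ->
      (forall i, S (s i)) -> hits_controlled P As t s ->
      forall x, X x -> `|n%:R^-1 * \sum_(i < n) f x (s i) - Ef P f x| <= eta].
Proof.
move=> eta0; have C0 := C_ge0.
(* The three errors below add up to at most (3 + 6 * C) * e. *)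
pose e := eta / (3 + 6 * C).
have C1 : 0 < 3 + 6 * C by lra.
have e0 : 0 < e by rewrite divr_gt0.
have [delta [E [delta0 mE _ PE EE]]] := exists_equicontinuous_set e0.
have [ys [ysX ys_net]] := compact_net X_compact delta0.
have [t [As [t0 mAs AsP]]] := mean_le_test_sets_seq e0 ysX.
pose t' := Num.min 1 (Num.min t e).
have t'0 : 0 < t' by rewrite !lt_min ltr01 t0.
have [t'1 t't t'e] : [/\ t' <= 1, t' <= t & t' <= e].
  by split; rewrite !ge_min lexx ?orbT.
exists t', (~` E :: As); split=> [|A|n s n0 sS ctl x Xx].
- by rewrite t'0.
- by rewrite inE => /predU1P[->|/mAs//]; exact: measurableC.
have [y yys yx] := ys_net x Xx.
have Xy := ysX _ yys.
have xy : ball x delta y by exact: ball_sym.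
have hitsE : hits (~` E) s <= n%:R * (fine (P (~` E)) + t').
  by apply: ctl; rewrite inE eqxx.
have D1 := mean_equicontinuous PE (ltW e0) EE Xx Xy xy n0 sS hitsE.
have D2 := Ef_equicontinuous mE PE (ltW e0) EE Xy Xx yx.
have ctl' : hits_controlled P As t' s.
  by move=> A AsA; apply: ctl; rewrite inE AsA orbT.
have D3 := AsP _ _ _ n0 t't sS ctl' y yys.
have -> : eta = e * (3 + 6 * C) by rewrite divfK// gt_eqF.
have Ct : C * t' <= C * e by rewrite ler_wpM2l.
move: D1 D2 D3; set a := _ * _; set b := _ * _; move=> D1 D2 D3.
have -> : a - Ef P f x = (a - b) + (b - Ef P f y) + (Ef P f y - Ef P f x) by ring.
rewrite (le_trans (ler_normD _ _))// (le_trans (lerD (ler_normD _ _) (lexx _)))//.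
apply: (le_trans (lerD (lerD D1 D3) D2)).
have -> : e * (3 + 6 * C) = 3 * e + 6 * (C * e) by ring.
have -> : e + 2 * C * (e + t') + e + (e + 2 * C * e) =
  3 * e + 4 * (C * e) + 2 * (C * t') by ring.
lra.
Qed.

Lemma Ef_bounded x : X x -> `|Ef P f x| <= C.
Proof.
move=> Xx; have ix := section_integrable Xx.
have inorm : P.-integrable (S : set (borel_rV R d))
    (EFin \o (fun xi : borel_rV R d => `|f x xi|)).
  exact: (integrable_norm ix).
have iC : P.-integrable (S : set (borel_rV R d))
    (EFin \o (fun xi : borel_rV R d => C)).
  by apply: (@bounded_integrable _ _ _ _ `|C|).
apply: (le_trans (le_normr_Rintegral mS ix)).
apply: (le_trans (le_Rintegral mS inorm iC (fun xi => f_le Xx))).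
by rewrite Rintegral_cst// [X in _ * fine X](probability_law_support P) mulr1.
Qed.

Context dO (Omega : measurableType dO).

Lemma measurable_f_comp (x : Omega -> borel_rV R dx) (s : Omega -> borel_rV R d) :
  measurable_fun setT x -> (forall w, X (x w)) ->
  measurable_fun setT s -> (forall w, S (s w)) ->
  measurable_fun setT (fun w => f (x w) (s w)).
Proof.
move=> mx Xx ms Ss.
apply: (measurable_comp _ _ mf (g := fun w => (x w, s w))).
- by apply: measurableX => //; exact: measurable_decision_set.
- by move=> _ [w _ <-]; split; [exact: Xx|exact: Ss].
- exact: measurable_fun_pair.
Qed.

(** [Ef] is continuous on [X], so its sublevel sets are relatively open. *)
Lemma measurable_Ef_comp (x : Omega -> borel_rV R dx) :
  measurable_fun setT x -> (forall w, X (x w)) ->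
  measurable_fun setT (fun w => Ef P f (x w)).
Proof.
move=> mx Xx; apply: (measurability _ (RGenInftyO.measurableE R)).
move=> _ [_ [c ->] <-]; rewrite setTI.
pose U : set 'rV[R]_dx := [set y | X y -> Ef P f y < c]^°.
have oU : open U by exact: open_interior.
have -> : (fun w => Ef P f (x w)) @^-1` `]-oo, c[ = x @^-1` U.
  apply/seteqP; split=> w; rewrite /= in_itv/=; last first.
    by move=> /interior_subset; apply; exact: Xx.
  move=> lt_c; have e0 : 0 < (c - Ef P f (x w)) / 2 by rewrite divr_gt0// subr_gt0.
  have [delta delta0 deltaP] := Ef_uniformly_continuous e0.
  apply: filterS (nbhsx_ballx (x w : 'rV[R]_dx) delta delta0) => y xy Xy.
  have := deltaP _ _ (Xx w) Xy xy; rewrite ler_distl => /andP[H _].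
  by move: H lt_c; lra.
by rewrite -[X in measurable X]setTI; apply: mx => //; exact: sub_sigma_algebra.
Qed.

End bounded_program.
(** * Sample sizes and summability of the error probabilities *)

Section sample_sizes.
Context (R : realType).

(** Induction on the sharper bound 2 - 1 / n. *)
Lemma sum_inverse_squares n : \sum_(k < n) (k.+1%:R ^- 2 : R) <= 2.
Proof.
suff H m : \sum_(k < m.+1) (k.+1%:R ^- 2 : R) <= 2 - m.+1%:R^-1.
  case: n => [|n]; first by rewrite big_ord0.
  by apply: le_trans (H n) _; rewrite gerBl invr_ge0.
elim: m => [|m IH]; first by rewrite big_ord1 expr1n invr1; lra.
rewrite big_ord_recr/= (le_trans (lerD IH (lexx _)))//.
have m0 : 0 < m.+1%:R :> R by rewrite ltr0n.
rewrite -[m.+2%:R]natr1; set x : R := m.+1%:R in m0 *.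
rewrite -lerBrDl.
have -> : 2 - (x + 1)^-1 - (2 - x^-1) = (x * (x + 1))^-1.
  by field; rewrite !gt_eqF//; lra.
by rewrite lef_pV2 ?posrE ?exprn_gt0 ?mulr_gt0//; nra.
Qed.

(** With [L] = ln(k + 1), this is a * L ^ 2 >= 2 * L - 1 / a, a completed square. *)
Lemma exp_log_square_le (a : R) k : 0 < a ->
  expR (- (a * (ln k.+1%:R) ^+ 2)) <= expR a^-1 * k.+1%:R ^- 2.
Proof.
move=> a0; set L := ln _.
have kE : k.+1%:R ^- 2 = expR (- (2 * L)) :> R.
  by rewrite -[X in X ^- 2](lnK (x := k.+1%:R)) ?posrE// -expRM_natl expRN mulr_natl.
rewrite kE -expRD ler_expR.
have -> : - (a * L ^+ 2) = a^-1 - 2 * L - a^-1 * (a * L - 1) ^+ 2.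
  by field; rewrite gt_eqF.
by rewrite gerBl mulr_ge0 ?invr_ge0 ?sqr_ge0// ltW.
Qed.

(** The squared logarithm in the sample size makes the error probabilities
    summable over the iterations, and the common factor [D] makes the sum
    small. *)
Lemma sum_error_probabilities (rho p : R) B : 0 < rho < 1 -> 0 < p -> (0 < B)%N ->
  exists G : R -> R, (forall a, 0 < a ->
      exists2 D0, 0 < D0 & forall D, D0 <= D -> G D <= a) /\
    forall D (N : nat -> nat), 0 < D ->
      (forall k, D * (1 + 2 * p * (ln k.+1%:R) ^+ 2) <= (N k)%:R) ->
      forall n, \sum_(k < n) rho ^+ (N k %/ B) <= G D.
Proof.
move=> /andP[rho0 rho1] p0 B0.
have BR0 : 0 < B%:R :> R by rewrite ltr0n.
pose c := - ln rho / B%:R.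
have lnrho : ln rho < 0 by rewrite ln_lt0// rho0.
have c0 : 0 < c by rewrite divr_gt0// oppr_gt0.
have rhoE N : rho ^+ (N %/ B) <= rho^-1 * expR (- (c * N%:R)).
  have -> : rho^-1 = expR (- ln rho) by rewrite expRN lnK.
  rewrite -[X in X ^+ _](lnK (x := rho)) ?posrE// -expRM_natl -expRD ler_expR.
  have NB : N%:R <= B%:R * (1 + (N %/ B)%:R) :> R.
    by rewrite addrC natr1 -natrM ler_nat ltnW// mulnC ltn_ceil.
  have -> : - ln rho - c * N%:R = c * (B%:R - N%:R).
    by rewrite mulrBr /c divfK// gt_eqF.
  have -> : (N %/ B)%:R * ln rho = c * (- (B%:R * (N %/ B)%:R)).
    by rewrite mulrN mulrA /c divfK ?gt_eqF// mulNr opprK mulrC.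
  by rewrite ler_pM2l//; move: NB; rewrite mulrDr mulr1; lra.
clearbody c.
pose G D := 2 * rho^-1 * expR ((2 * p * c * D)^-1 - c * D).
exists G; split.
  move=> a a0.
  pose D1 := (2 * p * c)^-1; pose D2 := 2 * rho^-1 * expR 1 / (c * a).
  have pc0 : 0 < 2 * p * c by rewrite !mulr_gt0.
  have D10 : 0 < D1 by rewrite invr_gt0.
  exists (Num.max D1 D2); first by rewrite lt_max D10.
  move=> D; rewrite ge_max => /andP[D1D D2D].
  have D0 : 0 < D by exact: lt_le_trans D1D.
  have cD0 : 0 < c * D by exact: mulr_gt0.
  rewrite /G expRD mulrA.
  apply: (@le_trans _ _ (2 * rho^-1 * expR 1 * (c * D)^-1)).
    apply: ler_pM.
    - by rewrite mulr_ge0 ?expR_ge0// mulr_ge0// invr_ge0 ltW.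
    - exact: expR_ge0.
    - apply: ler_wpM2l; first by rewrite mulr_ge0// invr_ge0 ltW.
      rewrite ler_expR.
      rewrite invf_le1 ?mulr_gt0//.
      by move: D1D; rewrite /D1 -ler_pdivrMl ?mulr1.
    - rewrite expRN lef_pV2 ?posrE ?expR_gt0//.
      by apply: le_trans (expR_ge1Dx _); rewrite lerDr.
  by move: D2D; rewrite /D2 !ler_pdivrMr// ?mulr_gt0// mulrA (mulrC D) (mulrC a).
move=> D N D0 ND n.
have a0 : 0 < 2 * p * c * D by rewrite !mulr_gt0.
apply: (@le_trans _ _ (\sum_(k < n) (rho^-1 * expR (- (c * D)) *
    expR (2 * p * c * D)^-1) * k.+1%:R ^- 2)).
  apply: ler_sum => k _; apply: (le_trans (rhoE _)).
  rewrite -[leRHS]mulrA -[leRHS]mulrA ler_wpM2l ?invr_ge0 ?(ltW rho0)//.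
  apply: (@le_trans _ _ (expR (- (c * D)) * expR (- (2 * p * c * D * (ln k.+1%:R) ^+ 2)))).
    rewrite -expRD ler_expR -opprD lerN2.
    apply: le_trans (ler_wpM2l (ltW c0) (ND k)).
    by rewrite le_eqVlt; apply/orP; left; apply/eqP; ring.
  by rewrite ler_wpM2l ?expR_ge0// exp_log_square_le.
rewrite -mulr_sumr /G addrC expRD [leRHS](_ : _ = rho^-1 * expR (- (c * D)) *
  expR (2 * p * c * D)^-1 * 2); last by ring.
rewrite ler_wpM2l ?sum_inverse_squares//.
by rewrite !mulr_ge0 ?expR_ge0// invr_ge0 ltW.
Qed.

End sample_sizes.
(** * Error event of a single sample *)

Section sample_support.
Context (R : realType) (d : nat) (P : probability (borel_rV R d) R).
Context (Finv : 'I_d -> R -> R).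
Hypothesis indep_components : mutually_independent P
  (fun j : 'I_d => preimage_set_system setT (@coord_rV R d j) measurable).
Hypothesis Finv_inv : forall j, inverse_cdf P j (Finv j).

(** Every coordinate is a quantile, so boxes around the point have positive
    probability, by independence. *)
Lemma quantile_point_support (p : 'I_d -> R) : (forall j, 0 < p j < 1) ->
  law_support P (\row_j Finv j (p j)).
Proof.
move=> p01 U oU Ux; set x := \row_j _ in Ux *.
have /nbhs_ballP[e e0 xeU] : nbhs x U by exact: open_nbhs_nbhs.
pose B j := ball (Finv j (p j)) e : set R.
have mB j : measurable (B j) by exact: measurable_ball.
apply: (@lt_le_trans _ _ (P (box B))).
  rewrite (independent_box indep_components mB).
  apply: (big_ind (fun y : \bar R => (0 < y)%E)) => //.
    by move=> y z; exact: mule_gt0.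
  by move=> j _; apply: marginal_ball_gt0 => //; exact: p01.
apply: le_measure; rewrite ?inE.
- exact: measurable_box.
- exact: sub_sigma_algebra.
move=> y By; apply: xeU; split=> // i j.
by rewrite [i]ord1 mxE; exact: By.
Qed.

End sample_support.

Section sample_error.
Context (R : realType) (d n : nat) (P : probability (borel_rV R d) R).
Context (Finv : 'I_d -> R -> R).
Context dO (Omega : measurableType dO) (Pr : probability Omega R).
Variables (u : 'I_d -> 'I_n -> {RV Pr >-> R}) (sigma : 'I_d -> Omega -> 'S_n).
Hypothesis n_gt0 : (0 < n)%N.
Hypothesis indep_components : mutually_independent P
  (fun j : 'I_d => preimage_set_system setT (@coord_rV R d j) measurable).
Hypothesis Finv_inv : forall j, inverse_cdf P j (Finv j).
Hypothesis u_strata : forall j i, stratified_draw i (u j i).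
Hypothesis sigma_unif : forall j, uniform_permutation Pr (sigma j).
Hypothesis indep : lhs_independent u sigma.

Lemma lhs_point_support i w : law_support P (lhs_point Finv u sigma i w).
Proof.
apply: (quantile_point_support indep_components Finv_inv) => j.
exact: stratified_draw01 (u_strata _ _) w.
Qed.

(** Union bound over the test sets.  The order of the factorial moment is
    n %/ b, so that it is at most the fraction 1 / b of [n]. *)
Lemma hits_uncontrolled_event (As : seq (set (borel_rV R d))) (t : R) b :
  (forall A, A \in As -> measurable A) -> 0 < t <= 1 ->
  2 * (2 * d%:R + 1) <= t * b%:R ->
  exists W : set Omega, [/\ measurable W,
    fine (Pr W) <= (size As)%:R * (1 + t / 2)^-1 ^+ (n %/ b) &
    forall w, ~ W w -> hits_controlled P As t (fun i => lhs_point Finv u sigma i w)].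
Proof.
move=> mAs t01 tb.
pose tail A := [set w | n%:R * (fine (P A) + t) <=
  hits A (fun i => lhs_point Finv u sigma i w)].
have mtail A : measurable A -> measurable (tail A).
  move=> mA; have -> : tail A = (fun w => hits A (fun i => lhs_point Finv u sigma i w))
      @^-1` `[n%:R * (fine (P A) + t), +oo[%classic.
    by apply/seteqP; split=> w; rewrite /tail/= in_itv/= andbT.
  rewrite -[X in measurable X]setTI.
  exact: (measurable_hits Finv_inv u_strata sigma_unif).
pose F A := if A \in As then tail A else set0.
have mF A : measurable (F A) by rewrite /F; case: ifPn => // /mAs; exact: mtail.
exists (\big[setU/set0]_(A <- As) F A); split.
- by apply: bigsetU_measurable => A _.
- apply: (le_trans (probability_bigsetU_le _ _ mF)).
  rewrite -sum1_size natr_sum mulr_suml big_seq [leRHS]big_seq.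
  apply: ler_sum => A AsA; rewrite mul1r /F AsA.
  apply: hits_tail => //; first exact: mAs.
  apply: (@le_trans _ _ (t * b%:R * (n %/ b)%:R)); first by rewrite ler_wpM2r.
  rewrite -mulrA ler_wpM2l//; first by case/andP: t01 => /ltW.
  by rewrite -natrM ler_nat mulnC leq_trunc_div.
move=> w nW A AsA; rewrite leNgt; apply/negP => lt_hits; apply: nW.
rewrite -bigcup_seq; exists A => //; rewrite /F AsA /tail /=.
exact: ltW.
Qed.

End sample_error.

Section independence_of_sources.
Context dO (Omega : measurableType dO) (R : realType) (Pr : probability Omega R).

(** Used to extract the sources of one sample from the sources of a whole run. *)
Lemma mutually_independent_comp (I J : eqType) (E : I -> set_system Omega)
    (g : J -> I) : injective g ->
  mutually_independent Pr E -> mutually_independent Pr (E \o g).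
Proof.
move=> g_inj indE s A us EA.
(* Since [g] is injective, [A' (g j)] is [A j]. *)
pose A' i := [set w | forall j, j \in s -> g j = i -> A j w].
have A'g j : j \in s -> A' (g j) = A j.
  move=> js; apply/seteqP; split=> [w|w Aw j' _ /g_inj ->//].
  by move=> /(_ j js erefl).
have := indE (map g s) A'; rewrite big_map (map_inj_uniq g_inj).
rewrite (eq_big_seq (fun j => Pr (A j))); last by move=> j js /=; rewrite A'g.
move=> <-//; last first.
  by move=> _ /mapP[j js ->]; rewrite A'g//; exact: EA.
congr (Pr _); apply/seteqP; split=> w Aw.
  by move=> _ /mapP[j js ->]; rewrite A'g//; exact: Aw.
by move=> j js; rewrite -A'g//; apply: Aw; exact: map_f.
Qed.

Lemma lhs_independent_of_sources (dx d q : nat) (m : nat -> nat)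
    (x_ : nat -> {RV Pr >-> borel_rV R dx})
    (u : forall k, 'I_q -> 'I_d -> 'I_(m k) -> {RV Pr >-> R})
    (sigma : forall k, 'I_q -> 'I_d -> Omega -> 'S_(m k)) k r :
  (forall j i, measurable_fun setT (u k r j i)) ->
  (forall j s, measurable (sigma k r j @^-1` [set s])) ->
  mutually_independent Pr (source_sigma x_ u sigma) ->
  lhs_independent (u k r) (sigma k r).
Proof.
move=> mu msigma.
pose g (c : 'I_d * 'I_(m k) + 'I_d) : source m q d := match c with
  | inl (j, i) => Some (inl (existT _ k (r, j, i)))
  | inr j => Some (inr (k, r, j)) end.
have inl_inj (S T : Type) (a b : S) : @inl S T a = inl b -> a = b by case.
have g_inj : injective g.
  move=> [[j i]|j] [[j' i']|j']//= /Some_inj.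
    move=> e; have H := inl_inj _ _ _ _ e.
    have := eq_from_Tagged (T_ := fun k => ('I_q * 'I_d * 'I_(m k))%type) H.
    by case=> -> ->.
  by case=> ->.
move=> /(mutually_independent_comp g_inj) ind A E mA.
pose Ev (c : 'I_d * 'I_(m k) + 'I_d) := match c with
  | inl (j, i) => u k r j i @^-1` A j i
  | inr j => sigma k r j @^-1` E j end.
have mu' j i : measurable (u k r j i @^-1` A j i).
  by rewrite -[X in measurable X]setTI; exact: mu.
have ms j : measurable (sigma k r j @^-1` E j).
  have -> : sigma k r j @^-1` E j = \bigcup_(s in E j) (sigma k r j @^-1` [set s]).
    by apply/seteqP; split=> [w Ew|w [s Es /= ->]] //; exists (sigma k r j w).
  by apply: fin_bigcup_measurable => [|s _]; [exact: finite_finset|].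
have evP c : c \in index_enum ('I_d * 'I_(m k) + 'I_d)%type ->
    (source_sigma x_ u sigma \o g) c (Ev c).
  case: c => [[j i]|j] _ /=; first by exists (A j i) => //; rewrite setTI.
  by exists (E j) => //; rewrite setTI.
have PrE := ind _ Ev (index_enum_uniq _) evP.
have setE : \bigcap_(c in [set` index_enum ('I_d * 'I_(m k) + 'I_d)%type]) Ev c =
    \big[setI/setT]_(j < d) \big[setI/setT]_(i < m k) (u k r j i @^-1` A j i)
    `&` \big[setI/setT]_(j < d) (sigma k r j @^-1` E j).
  rewrite bigcap_seq big_sumType/=.
  rewrite (eq_bigr (fun c => u k r c.1 c.2 @^-1` A c.1 c.2)); last by case.
  by rewrite (pair_bigA _ (fun j i => u k r j i @^-1` A j i)).
rewrite -setE PrE big_sumType/=.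
rewrite (eq_bigr (fun c => (fine (Pr (u k r c.1 c.2 @^-1` A c.1 c.2)))%:E)); last first.
  by move=> [j i] _ /=; rewrite fineK// fin_num_measure.
rewrite (eq_bigr (fun j => (fine (Pr (sigma k r j @^-1` E j)))%:E)); last first.
  by move=> j _; rewrite fineK// fin_num_measure.
by rewrite !prodEFin -EFinM/= (pair_bigA _ (fun j i => fine (Pr (u k r j i @^-1` A j i)))).
Qed.

End independence_of_sources.
(** * The sequential procedure with estimators of controlled accuracy *)

Section stopping.
Context (R : realType) dO (Omega : measurableType dO) (Pr : probability Omega R).
Variables (h' h eps' eps eta : R) (GAP SV G : nat -> Omega -> R).

Let stops k : set Omega := [set w | GAP k w <= h' * Num.sqrt (SV k w) + eps'].

Let first k : set Omega := stops k `&` \bigcap_(l in `I_k) ~` stops l.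

Let T := stopping_time h' eps' GAP SV.

Lemma first_stopping_time k w : first k w -> T w = k.+1%:R%:E.
Proof.
move=> [kw lkw]; apply/eqP; rewrite eq_le; apply/andP; split.
  by apply: ereal_inf_lbound; exists k.
apply: le_ereal_inf_tmp => _ [l lw <-]; rewrite lee_fin ler_nat ltnS leqNgt.
by apply/negP => lk; exact: lkw lw.
Qed.

Lemma exists_first w : (exists k, stops k w) -> exists k, first k w.
Proof.
move=> ex; have ex' : exists k, `[< stops k w >] by have [k kw] := ex; exists k; apply/asboolP.
have [k /asboolP kw kmin] := ex_minnP ex'.
exists k; split=> // l lk /asboolP lw.
by have := kmin l lw; rewrite leqNgt lk.
Qed.

Lemma stopping_time_lty w : (T w < +oo)%E <-> exists k, stops k w.
Proof.
split=> [Tw|/exists_first[k /first_stopping_time ->]]; last exact: ltry.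
apply: contrapT => nex; suff Ty : T w = +oo%E by rewrite Ty ltxx in Tw.
rewrite /T /stopping_time (_ : [set _ | _ in _] = set0) ?ereal_inf0//.
by apply/seteqP; split=> // y /= [k kw _]; apply: nex; exists k.
Qed.

Lemma stopping_time_eq k w : T w = k.+1%:R%:E <-> first k w.
Proof.
split=> [Tw|]; last exact: first_stopping_time.
have [l lw] : exists l, first l w.
  by apply: exists_first; apply/stopping_time_lty; rewrite Tw ltry.
have [/eqP] := etrans (esym Tw) (first_stopping_time lw).
by rewrite eqr_nat eqSS => /eqP ->.
Qed.

Hypotheses (mGAP : forall k, measurable_fun setT (GAP k))
  (mSV : forall k, measurable_fun setT (SV k))
  (mG : forall k, measurable_fun setT (G k)).
Hypotheses (h'0 : 0 <= h') (h'h : h' <= h) (eta_eps' : 3 * eta <= eps')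
  (eta_eps : eps' + 2 * eta <= eps).
(* In the application [V k] is the event that a sample of iteration [k] is
   inaccurate and [G k] is the true optimality gap of the candidate. *)
Variable V : nat -> set Omega.
Hypotheses (mV : forall k, measurable (V k))
  (V_summable : (\sum_(0 <= k <oo) Pr (V k) < +oo)%E).
Hypothesis GAP_upper : forall k w, ~ V k w -> GAP k w <= G k w + 2 * eta.
Hypothesis GAP_lower :
  {ae Pr, forall w, forall k, ~ V k w -> G k w <= GAP k w + 2 * eta}.
Hypothesis G_small : {ae Pr, forall w, forall m, exists2 k, (m <= k)%N & G k w <= eta}.

Let msqrt k : measurable_fun setT (fun w => Num.sqrt (SV k w)).
Proof.
apply: (measurableT_comp (f := @Num.sqrt R)) => //.
by apply: continuous_measurable_fun; exact: sqrt_continuous.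
Qed.

Let mstops k : measurable (stops k).
Proof.
have mD : measurable_fun setT (fun w => h' * Num.sqrt (SV k w) + eps' - GAP k w).
  apply: measurable_funB => //; apply: measurable_funD => //.
  exact: measurable_funM.
have -> : stops k = (fun w => h' * Num.sqrt (SV k w) + eps' - GAP k w) @^-1` `[0, +oo[.
  by apply/seteqP; split=> w; rewrite /stops/= in_itv/= andbT subr_ge0.
by rewrite -[X in measurable X]setTI; exact: mD.
Qed.

Let mfirst k : measurable (first k).
Proof.
apply: measurableI => //; apply: bigcap_measurableType => l _.
exact: measurableC.
Qed.

Lemma probability_ae1 (A : set Omega) : measurable A -> {ae Pr, forall w, A w} ->
  Pr A = 1%E.
Proof.
move=> mA aeA; rewrite -[A]setCK probability_setC; last exact: measurableC.
rewrite (_ : Pr (~` A) = 0%E) ?sube0//.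
by apply: measure_negligible => //; exact: measurableC.
Qed.

(** Almost surely only finitely many [V k] occur, by Borel-Cantelli, and a later
    candidate of small gap stops the procedure. *)
Lemma ae_stops : {ae Pr, forall w, exists k, stops k w}.
Proof.
have VBC : Pr (lim_sup_set V) = 0%E by exact: lim_sup_set_cvg0.
have mlim : measurable (lim_sup_set V).
  by apply: bigcapT_measurable => m; apply: bigcup_measurable => k _; exact: mV.
have aeV : {ae Pr, forall w, ~ lim_sup_set V w}.
  have : Pr.-negligible (lim_sup_set V) by apply/negligibleP.
  by apply: negligibleS => w /= /contrapT.
apply: filterS2 aeV G_small => w nlim small.
have [m Vm] : exists m, forall k, (m <= k)%N -> ~ V k w.
  apply: contrapT => nex; apply: nlim => m _; apply: contrapT => nV.
  by apply: nex; exists m => k mk Vk; apply: nV; exists k.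
have [k mk Gk] := small m; exists k; rewrite /stops/=.
have := GAP_upper (Vm k mk).
have : 0 <= h' * Num.sqrt (SV k w) by rewrite mulr_ge0// sqrtr_ge0.
by move: Gk eta_eps'; lra.
Qed.

Lemma stops_almost_surely : Pr [set w | (T w < +oo)%E] = 1%E.
Proof.
have -> : [set w | (T w < +oo)%E] = \bigcup_k stops k.
  apply/seteqP; split=> w; first by move/stopping_time_lty => [k kw]; exists k.
  by move=> [k _ kw]; apply/stopping_time_lty; exists k.
apply: probability_ae1; first exact: bigcupT_measurable.
by apply: filterS ae_stops => w [k kw]; exists k.
Qed.

(** If no [V k] occurs, the stopping inequality transfers from the estimated gap
    to the true gap, at the cost of [2 * eta]. *)
Lemma stopped_gap_probability :
  (1 - \sum_(0 <= k <oo) Pr (V k) <=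
  Pr [set w | exists2 k, T w = k.+1%:R%:E & (G k w <= h * Num.sqrt (SV k w) + eps)%R])%E.
Proof.
set Ev := [set w | _].
pose good k := [set w | G k w <= h * Num.sqrt (SV k w) + eps].
have mgood k : measurable (good k).
  have mD : measurable_fun setT (fun w => h * Num.sqrt (SV k w) + eps - G k w).
    apply: measurable_funB => //; apply: measurable_funD => //.
    exact: measurable_funM.
  have -> : good k = (fun w => h * Num.sqrt (SV k w) + eps - G k w) @^-1` `[0, +oo[.
    by apply/seteqP; split=> w; rewrite /good/= in_itv/= andbT subr_ge0.
  by rewrite -[X in measurable X]setTI; exact: mD.
have EvE : Ev = \bigcup_k (first k `&` good k).
  apply/seteqP; split=> w; first by move=> [k /stopping_time_eq kw Gk]; exists k.
  by move=> [k _ [kw Gk]]; exists k => //; apply/stopping_time_eq.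
have mEv : measurable Ev.
  by rewrite EvE; apply: bigcupT_measurable => k; exact: measurableI.
have mUV : measurable (\bigcup_k V k) by exact: bigcupT_measurable.
have one : Pr (Ev `|` \bigcup_k V k) = 1%E.
  apply: probability_ae1; first exact: measurableU.
  apply: filterS2 ae_stops GAP_lower => w /exists_first[k kw] lower.
  have [Vk|nVk] := pselect (V k w); first by right; exists k.
  left; rewrite EvE; exists k => //; split=> //; rewrite /good/=.
  have := lower k nVk; have [+ _] := kw; rewrite /stops/=.
  have : h' * Num.sqrt (SV k w) <= h * Num.sqrt (SV k w).
    by rewrite ler_wpM2r// sqrtr_ge0.
  by move: eta_eps; lra.
rewrite lee_subel_addr ?fin_num_measure//.
rewrite -one (le_trans (measureU2 _ mEv mUV))// leeD2l//.
exact: measure_sigma_subadditive.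
Qed.

End stopping.
(** * Gap estimators on accurate samples *)

Section gap_estimates.
Context (R : realType) (dx d : nat) (X : set 'rV[R]_dx).
Context (P : probability (borel_rV R d) R) (f : 'rV[R]_dx -> 'rV[R]_d -> R).
Context (C : R) (Ef_le : forall x, X x -> `|Ef P f x| <= C).

Lemma zstar_le x : X x -> zstar X P f <= Ef P f x.
Proof.
move=> Xx; apply: ge_inf; last by exists x.
exists (- C) => _ [y Xy <-].
by have := Ef_le Xy; rewrite ler_norml => /andP[].
Qed.

Lemma le_zstar x c : X x -> (forall y, X y -> c <= Ef P f y) -> c <= zstar X P f.
Proof.
move=> Xx c_le; apply: lb_le_inf; first by exists (Ef P f x), x.
by move=> _ [y Xy <-]; exact: c_le.
Qed.

Variables (eta : R) (n : nat).

Definition accurate (s : 'I_n -> 'rV[R]_d) := forall x, X x ->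
  `|n%:R^-1 * \sum_(i < n) f x (s i) - Ef P f x| <= eta.

Lemma gapSE x y (s : 'I_n -> 'rV[R]_d) : gapS f x y s =
  n%:R^-1 * \sum_(i < n) f x (s i) - n%:R^-1 * \sum_(i < n) f y (s i).
Proof. by rewrite /gapS sumrB mulrBr. Qed.

(** The sample solution [y] has expectation at least [zstar]. *)
Lemma gapS_le x y (s : 'I_n -> 'rV[R]_d) : X x -> X y -> accurate s ->
  gapS f x y s <= optimality_gap X P f x + 2 * eta.
Proof.
move=> Xx Xy acc; rewrite gapSE /optimality_gap.
have := acc x Xx; have := acc y Xy; have := zstar_le Xy.
by rewrite !ler_distl => ? /andP[? ?] /andP[? ?]; lra.
Qed.

(** By optimality of [y], the estimator is at least the gap to any other [z]. *)
Lemma gapS_ge x y (s : 'I_n -> 'rV[R]_d) : X x -> saa_optimal f X s y ->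
  accurate s -> optimality_gap X P f x <= gapS f x y s + 2 * eta.
Proof.
move=> Xx [Xy y_opt] acc; rewrite gapSE /optimality_gap.
suff : Ef P f x - (gapS f x y s + 2 * eta) <= zstar X P f.
  by rewrite gapSE; lra.
apply: (le_zstar Xx) => z Xz; rewrite gapSE.
have := acc x Xx; have := acc z Xz; have := y_opt z Xz.
by rewrite !ler_distl => ? /andP[? ?] /andP[? ?]; lra.
Qed.

Variable a : assessment.

Lemma nrep_gt0 : (0 < nrep a)%N.
Proof. by case: a. Qed.

Let q0 : 0 < (nrep a)%:R :> R.
Proof. by rewrite ltr0n nrep_gt0. Qed.

Let sumE (c : R) : (nrep a)%:R * c = \sum_(r < nrep a) c.
Proof. by rewrite sumr_const card_ord mulr_natl. Qed.

Lemma gap_le x (y : 'I_(nrep a) -> 'rV[R]_dx) (s : 'I_(nrep a) -> 'I_n -> 'rV[R]_d) :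
  X x -> (forall r, X (y r)) -> (forall r, accurate (s r)) ->
  gap f x y s <= optimality_gap X P f x + 2 * eta.
Proof.
move=> Xx Xy acc; rewrite /gap ler_pdivrMl// sumE.
by apply: ler_sum => r _; exact: gapS_le.
Qed.

Lemma gap_ge x (y : 'I_(nrep a) -> 'rV[R]_dx) (s : 'I_(nrep a) -> 'I_n -> 'rV[R]_d) :
  X x -> (forall r, saa_optimal f X (s r) (y r)) -> (forall r, accurate (s r)) ->
  optimality_gap X P f x <= gap f x y s + 2 * eta.
Proof.
move=> Xx y_opt acc; rewrite -lerBlDr /gap ler_pdivlMl// sumE.
by apply: ler_sum => r _; rewrite lerBlDr; exact: gapS_ge.
Qed.

Context dO (Omega : measurableType dO).
Variables (x : Omega -> 'rV[R]_dx) (y : 'I_(nrep a) -> Omega -> 'rV[R]_dx).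
Variable s : 'I_(nrep a) -> 'I_n -> Omega -> 'rV[R]_d.
Hypotheses (mfx : forall r i, measurable_fun setT (fun w => f (x w) (s r i w)))
  (mfy : forall r i, measurable_fun setT (fun w => f (y r w) (s r i w))).

Let mdiff r i : measurable_fun setT
  (fun w => f (x w) (s r i w) - f (y r w) (s r i w)).
Proof. exact: measurable_funB. Qed.

Let mgapS r : measurable_fun setT
  (fun w => gapS f (x w) (y r w) (fun i => s r i w)).
Proof.
apply: measurable_funM => //.
by apply: measurable_sum => i; exact: mdiff.
Qed.

Lemma measurable_gap : measurable_fun setT
  (fun w => gap f (x w) (fun r => y r w) (fun r i => s r i w)).
Proof.
apply: measurable_funM => //.
by apply: measurable_sum => r; exact: mgapS.
Qed.

Lemma measurable_sv : measurable_fun setT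
  (fun w => sv f (x w) (fun r => y r w) (fun r i => s r i w)).
Proof.
apply: measurable_funM => //; apply: measurable_sum => r.
apply: measurable_funM => //; apply: measurable_sum => i.
by apply: measurable_funX; apply: measurable_funB; [exact: mdiff|exact: mgapS].
Qed.

End gap_estimates.

(** Candidates come back near the optimal [z], where [Ef] varies little. *)
Lemma cluster_small_gap (R : realType) (dx d : nat) (X : set 'rV[R]_dx)
    (P : probability (borel_rV R d) R) (f : 'rV[R]_dx -> 'rV[R]_d -> R)
    (eta delta : R) (x : nat -> 'rV[R]_dx) z :
  0 < delta -> (forall k, X (x k)) -> Xstar X P f z ->
  (forall y, X y -> ball z delta y -> `|Ef P f z - Ef P f y| <= eta) ->
  cluster (x k @[k --> \oo]) z ->
  forall m, exists2 k, (m <= k)%N & optimality_gap X P f (x k) <= eta.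
Proof.
move=> delta0 Xx [Xz z_opt] near_z clz m.
have [_ [[k mk <-] zk]] : [set x k | k in [set k | (m <= k)%N]] `&` ball z delta !=set0.
  apply: clz; last exact: nbhsx_ballx.
  by exists m => // k mk; exists k.
exists k => //; rewrite /optimality_gap.
have := near_z _ (Xx k) zk; rewrite ler_distl => /andP[H _].
by have := le_zstar Xz z_opt; move: H; lra.
Qed.

(** * Assessment by Latin hypercube samples *)

Theorem theorem2 (R : realType) (dx d : nat)
  (X : set 'rV[R]_dx)
  (P : probability (borel_rV R d) R)
  (f : 'rV[R]_dx -> 'rV[R]_d -> R)
  (mf : measurable_fun
          ((X : set (borel_rV R dx)) `*` (law_support P : set (borel_rV R d)))
          (fun z : borel_rV R dx * borel_rV R d => f z.1 z.2))
  (f_cont : {ae P, forall xi, {within X, continuous (fun x => f x xi)}})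
  (C : R) (C_gt0 : 0 < C)
  (f_bounded : (ereal_sup [set `|f z.1 z.2|%:E | z in X `*` law_support P]
                 <= C%:E)%E)
  (X_neq0 : X !=set0) (X_compact : compact X)
  (indep_components : mutually_independent P
     (fun j : 'I_d => preimage_set_system setT (@coord_rV R d j) measurable))
  (Finv : 'I_d -> R -> R)
  (cdf_invertible : forall j, inverse_cdf P j (Finv j))
  (m M : R) (mM_gt0 : 0 < m \/ 0 < M)
  (resid_ge : ((- m)%:E <= ereal_inf
     [set (anova_resid P f z.1 z.2)%:E | z in X `*` law_support P])%E)
  (resid_le : (ereal_sup
     [set (anova_resid P f z.1 z.2)%:E | z in X `*` law_support P] <= M%:E)%E)
  (main_regular : forall x, X x -> forall j : 'I_d,
     {within marginal_support P j, continuous (anova_main P f j x)} \/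
     (@lebesgue_measure R).-negligible
        (discontinuities (marginal_support P j) (anova_main P f j x)))
  (dO : measure_display) (Omega : measurableType dO)
  (Pr : probability Omega R)
  (x_ : nat -> {RV Pr >-> borel_rV R dx})
  (x_in_X : forall k w, X (x_ k w))
  (A1 : {ae Pr, forall w, exists2 z, Xstar X P f z &
          cluster ((x_ k w : 'rV[R]_dx) @[k --> \oo]) z})
  (a : assessment)
  (eps eps' h' p alpha : R)
  (eps'_gt0 : 0 < eps') (eps'_lt : eps' < eps)
  (h'_gt0 : 0 < h') (p_gt0 : 0 < p) (alpha_in : 0 < alpha < 1)
  (eps_resid : m + M < eps - eps')
  (n : R -> nat -> nat)
  (n_ge2 : forall h k, h' < h -> (2 <= n h k)%N)
  (n_mono : forall h k, h' < h -> (n h k <= n h k.+1)%N)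
  (n_ge : forall h k, h' < h ->
     ((h - h')^-1) ^+ 2 * (c_p p alpha + 2 * p * (ln k.+1%:R) ^+ 2)
       <= (n h k)%:R)
  (n_even : forall h k, h' < h -> a = A2RP -> ~~ odd (n h k))
  (n_large : forall h k, h' < h -> (2 <= n h k %/ nrep a)%N)
  (u : forall (h : R) (k : nat),
     'I_(nrep a) -> 'I_d -> 'I_(n h k %/ nrep a) -> {RV Pr >-> R})
  (sigma : forall (h : R) (k : nat),
     'I_(nrep a) -> 'I_d -> Omega -> 'S_(n h k %/ nrep a))
  (u_strata : forall h k r j i, h' < h -> stratified_draw i (u h k r j i))
  (sigma_unif : forall h k r j, h' < h ->
     uniform_permutation Pr (sigma h k r j))
  (indep_sources : forall h, h' < h ->
     mutually_independent Pr (source_sigma x_ (u h) (sigma h)))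
  (xstar : R -> nat -> 'I_(nrep a) -> {RV Pr >-> borel_rV R dx})
  (xstar_in_X : forall h k r w, h' < h -> X (xstar h k r w)) :
  let sample h k w r := lhs_sample Finv
    (fun j i => u h k r j i w) (fun j => sigma h k r j w) in
  let GAP h k w :=
    @gap R dx d f a (n h k %/ nrep a) (x_ k w)
      (fun r => xstar h k r w) (sample h k w) in
  let SV h k w :=
    @sv R dx d f a (n h k %/ nrep a) (x_ k w)
      (fun r => xstar h k r w) (sample h k w) in
  let T h := stopping_time h' eps' (GAP h) (SV h) in
  forall (xstar_opt : forall h k r, h' < h ->
    {ae Pr, forall w, saa_optimal f X (sample h k w r) (xstar h k r w)}),
  (forall h, h' < h -> Pr [set w | (T h w < +oo)%E] = 1%E) /\
  ((1 - alpha)%:E <= limf_einf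
     (fun h : R => Pr [set w | exists2 k, T h w = k.+1%:R%:E &
        (optimality_gap X P f (x_ k w) <= h * Num.sqrt (SV h k w) + eps)%R])
     h'^'+)%E.
Proof.
move=> sample GAP SV T xstar_opt.
have f_le x xi : X x -> law_support P xi -> `|f x xi| <= C.
  move=> Xx Sxi; rewrite -lee_fin; apply: le_trans f_bounded.
  by apply: ereal_sup_ubound; exists (x, xi).
pose q := nrep a; have q0 : (0 < q)%N by exact: nrep_gt0.
(* The two parts ask for 3 * eta <= eps' and for eps' + 2 * eta <= eps. *)
pose eta := Num.min (eps' / 3) ((eps - eps') / 2).
have eta0 : 0 < eta by rewrite lt_min !divr_gt0// subr_gt0.
have eta_eps' : 3 * eta <= eps'.
  have : eta <= eps' / 3 by rewrite ge_min lexx.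
  by lra.
have eta_eps : eps' + 2 * eta <= eps.
  have : eta <= (eps - eps') / 2 by rewrite ge_min lexx orbT.
  by lra.
have [t [As [t01 mAs AsP]]] :=
  uniform_lln_test_sets mf f_cont f_le X_neq0 X_compact eta0.
have t0 : 0 < t by case/andP: t01.
pose b := (Num.bound (2 * (2 * d%:R + 1) / t)).+1.
have tb : 2 * (2 * d%:R + 1) <= t * b%:R.
  rewrite [leRHS]mulrC -ler_pdivrMr//.
  apply: le_trans (ltW (archi_boundP _)) _; last by rewrite ler_nat leqnSn.
  by rewrite divr_ge0 ?(ltW t0)// mulr_ge0// addr_ge0// mulr_ge0.
pose rho : R := (1 + t / 2)^-1.
have rho01 : 0 < rho < 1.
  have t2 : 1 < 1 + t / 2 by lra.
  by rewrite invr_gt0 invf_lt1 (lt_trans ltr01 t2).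
have qb0 : (0 < q * b)%N by rewrite muln_gt0 q0.
have [G [G_small G_sum]] := sum_error_probabilities rho01 p_gt0 qb0.
pose K : R := q%:R * (size As)%:R.
pose D (h : R) := ((h - h')^-1) ^+ 2.
(* [D h] is the common factor of the sample sizes, and [V k] collects the error
   events of the replications of iteration [k]. *)
have errors h : h' < h -> exists V : nat -> set Omega,
    [/\ forall k, measurable (V k),
        (\sum_(0 <= k <oo) Pr (V k) <= (K * G (D h))%:E)%E &
        forall k w, ~ V k w -> forall r, accurate X P f eta (sample h k w r)].
  move=> hh'.
  have N0 k : (0 < n h k %/ q)%N by apply: leq_trans (n_large h k hh').
  have /choice[W WP] (kr : nat * 'I_q) : exists W : set Omega, [/\ measurable W,
      fine (Pr W) <= (size As)%:R * rho ^+ (n h kr.1 %/ q %/ b) &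
      forall w, ~ W w -> accurate X P f eta (sample h kr.1 w kr.2)].
    have ind : lhs_independent (u h kr.1 kr.2) (sigma h kr.1 kr.2).
      apply: (lhs_independent_of_sources (x_ := x_) (m := fun k => n h k %/ q)%N) => //.
      - by move=> j s; exact: (sigma_unif h kr.1 kr.2 j hh' s).1.
      - exact: indep_sources.
    have us j i : stratified_draw i (u h kr.1 kr.2 j i) by exact: u_strata.
    have su j := sigma_unif h kr.1 kr.2 j hh'.
    have [W [mW PW WC]] := hits_uncontrolled_event (N0 _) indep_components
      cdf_invertible us su ind mAs t01 tb.
    exists W; split=> // w nW x Xx.
    apply: (AsP _ _ (N0 kr.1)) => //; last exact: WC.
    by move=> i; exact: (lhs_point_support indep_components cdf_invertible us).
  pose V k := \big[setU/set0]_(r < q) W (k, r).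
  have mV k : measurable (V k).
    by apply: bigsetU_measurable => r _; have [] := WP (k, r).
  exists V; split=> [//||k w nV r]; last first.
    have [_ _ WC] := WP (k, r); apply: WC => Ww; apply: nV.
    by rewrite /V -bigcup_seq; exists r => //; exact: mem_index_enum.
  have PV k : fine (Pr (V k)) <= K * rho ^+ (n h k %/ (q * b)).
    apply: (le_trans (probability_bigsetU_le _ _ _)).
      by move=> r; have [] := WP (k, r).
    apply: (@le_trans _ _ (\sum_(r < q) (size As)%:R * rho ^+ (n h k %/ (q * b)))).
      by apply: ler_sum => r _; rewrite divnMA; have [] := WP (k, r).
    by rewrite sumr_const card_ord -[leLHS]mulr_natl mulrA.
  have D0 : 0 < D h by rewrite exprn_gt0// invr_gt0 subr_gt0.
  apply: lime_le; first exact: is_cvg_nneseries.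
  apply: nearW => N; rewrite big_mkord.
  rewrite (eq_bigr (fun k : 'I_N => (fine (Pr (V k)))%:E)); last first.
    by move=> k _; rewrite fineK// fin_num_measure.
  rewrite sumEFin lee_fin.
  apply: (@le_trans _ _ (\sum_(k < N) K * rho ^+ (n h k %/ (q * b)))).
    by apply: ler_sum => k _; exact: PV.
  rewrite -mulr_sumr ler_wpM2l ?mulr_ge0//; apply: G_sum => // k.
  apply: le_trans (n_ge h k hh'); apply: ler_wpM2l; first exact: ltW.
  rewrite lerD2r.
  by rewrite /c_p le_max lexx orbT.
have mpoint h k r i : h' < h ->
    measurable_fun setT (fun w => sample h k w r i : borel_rV R d).
  move=> hh'; have us j i' := u_strata h k r j i' hh'.
  exact: (measurable_lhs_point cdf_invertible us (fun j => sigma_unif h k r j hh') i).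
have Spoint h k r i w : h' < h -> law_support P (sample h k w r i).
  move=> hh'; have us j i' := u_strata h k r j i' hh'.
  exact: (lhs_point_support indep_components cdf_invertible us).
have mfx h k r i : h' < h -> measurable_fun setT (fun w => f (x_ k w) (sample h k w r i)).
  move=> hh'; apply: (measurable_f_comp mf X_compact (x := x_ k)
    (s := fun w => sample h k w r i)) => //; first exact: mpoint.
  by move=> w; exact: Spoint.
have mfy h k r i : h' < h ->
    measurable_fun setT (fun w => f (xstar h k r w) (sample h k w r i)).
  move=> hh'; apply: (measurable_f_comp mf X_compact (x := xstar h k r)
    (s := fun w => sample h k w r i)) => //.
  - by move=> w; exact: xstar_in_X.
  - exact: mpoint.
  - by move=> w; exact: Spoint.
have mGAP h k : h' < h -> measurable_fun setT (GAP h k).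
  by move=> hh'; apply: measurable_gap => r i; [exact: mfx|exact: mfy].
have mSV h k : h' < h -> measurable_fun setT (SV h k).
  by move=> hh'; apply: measurable_sv => r i; [exact: mfx|exact: mfy].
pose Gap k w := optimality_gap X P f (x_ k w).
have mGap k : measurable_fun setT (Gap k).
  apply: measurable_funB => //.
  exact: (measurable_Ef_comp mf f_cont f_le X_neq0 X_compact).
have Ef_le := Ef_bounded mf f_le X_compact.
have upper h V : h' < h ->
    (forall k w, ~ V k w -> forall r, accurate X P f eta (sample h k w r)) ->
    forall k w, ~ V k w -> GAP h k w <= Gap k w + 2 * eta.
  move=> hh' acc k w nV; apply: (gap_le Ef_le) => //.
  - by move=> r; exact: xstar_in_X.
  - exact: acc.
have lower h V : h' < h ->
    (forall k w, ~ V k w -> forall r, accurate X P f eta (sample h k w r)) ->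
    {ae Pr, forall w, forall k, ~ V k w -> Gap k w <= GAP h k w + 2 * eta}.
  move=> hh' acc; apply/ae_foralln => k.
  have opt : {ae Pr, forall w, forall r, saa_optimal f X (sample h k w r) (xstar h k r w)}.
    by apply: filter_forall => r; exact: xstar_opt.
  by apply: filterS opt => w opt nV; apply: gap_ge => //; exact: acc.
have small : {ae Pr, forall w, forall m, exists2 k, (m <= k)%N & Gap k w <= eta}.
  have [delta delta0 deltaP] :=
    Ef_uniformly_continuous mf f_cont f_le X_neq0 X_compact eta0.
  apply: filterS A1 => w [z Xz clz].
  apply: (cluster_small_gap delta0 _ Xz _ clz) => // y Xy zy.
  by apply: deltaP => //; case: Xz.
split=> [h hh'|].
  have [V [mV V_sum acc]] := errors h hh'.
  apply: (@stops_almost_surely _ _ _ _ h' eps' eta (GAP h) (SV h) Gap _ _ _ _ V) => //.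
  - by move=> k; exact: mGAP.
  - by move=> k; exact: mSV.
  - exact: ltW.
  - exact: le_lt_trans V_sum (ltry _).
  - exact: upper.
have /andP[alpha0 alpha1] := alpha_in.
have K0 : 0 <= K by rewrite mulr_ge0.
have [D0 D00 GD] := G_small (alpha / (K + 1)) (divr_gt0 alpha0 (ltr_wpDl K0 ltr01)).
set F := (F in limf_einf F _).
(* If 0 < h - h' <= 1, then (h - h') ^- 2 is at least (h - h')^-1. *)
pose delta := Num.min 1 D0^-1.
have delta0 : 0 < delta by rewrite lt_min ltr01 invr_gt0.
pose A := [set h : R | h' < h <= h' + delta].
have nA : (h'^'+) A.
  near=> h; rewrite /A /=; apply/andP; split; first by near: h; exact: nbhs_right_gt.
  by near: h; apply: nbhs_right_le; rewrite ltrDl.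
rewrite limf_einfE; apply: (@le_trans _ _ (ereal_inf (F @` A))); last first.
  by apply: ereal_sup_ubound; exists A.
apply: le_ereal_inf_tmp => _ [h /andP[hh' h_le] <-]; rewrite /F.
have [V [mV V_sum acc]] := errors h hh'.
have D_large : D0 <= D h.
  have hd : 0 < h - h' by rewrite subr_gt0.
  have : h - h' <= delta by rewrite lerBlDl.
  rewrite le_min => /andP[hd1 hdD]; rewrite /D.
  have inv1 : 1 <= (h - h')^-1 by rewrite invf_ge1.
  have invD : D0 <= (h - h')^-1 by rewrite -[D0]invrK lef_pV2 ?posrE ?invr_gt0.
  by rewrite expr2 (le_trans invD)// ler_peMr// (le_trans ler01).
have V_le : (\sum_(0 <= k <oo) Pr (V k) <= alpha%:E)%E.
  apply: (le_trans V_sum); rewrite lee_fin.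
  apply: (le_trans (ler_wpM2l K0 (GD _ D_large))).
  rewrite mulrCA ler_piMr ?(ltW alpha0)// ler_pdivrMr ?mul1r ?lerDl//.
  exact: ltr_wpDl.
apply: (@le_trans _ _ (1 - \sum_(0 <= k <oo) Pr (V k))%E).
  by rewrite EFinB leeB.
apply: (@stopped_gap_probability _ _ _ _ h' h eps' eps eta (GAP h) (SV h) Gap) => //.
- by move=> k; exact: mGAP.
- by move=> k; exact: mSV.
- exact: ltW.
- exact: ltW.
- exact: le_lt_trans V_sum (ltry _).
- exact: upper.
- exact: lower.
Unshelve. all: by end_near. Qed.
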